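(* Let $(Q,\lambda,J)$ be a contact triad, $(\Sigma,j)$ a closed or punctured Riemann surface with a Kähler metric $h$ with area form $dA$, and $w:\Sigma\to Q$ a smooth map. Let $\Upsilon(w)=(\Upsilon_1(w),\Upsilon_2(w))=(\overline\partial^\pi w,\,d(w^*\lambda\circ j))$, with linearization $D\Upsilon(w)=D\Upsilon_1(w)\oplus D\Upsilon_2(w):\Omega^0(w^*TQ)\to\Omega^{(0,1)}(w^*\xi)\oplus\Omega^2(\Sigma)$. Then for every $Y=Y^\pi+\lambda(Y)X_\lambda\in\Omega^0(w^*TQ)$, $$D\Upsilon_1(w)(Y)=\overline\partial^{\nabla^\pi}Y^\pi+T^{\pi,(0,1)}_{dw}(Y^\pi)+B^{(0,1)}(Y^\pi)+\tfrac12\lambda(Y)\,(\mathcal L_{X_\lambda}J)J(\partial^\pi w),$$ $$D\Upsilon_2(w)(Y)=-\Delta(\lambda(Y))\,dA+d\big((Y^\pi\rfloor d\lambda)\circ j\big),$$ where $T^{\pi,(0,1)}_{dw}$ and $B^{(0,1)}$ are the $(0,1)$-components of the zero-order operators $T^\pi_{dw},B:\Omega^0(w^*TQ)\to\Omega^1(w^*\xi)$ given by $$B(Y)=-\tfrac12\,w^*\lambda\,\big((\mathcal L_{X_\lambda}J)JY\big),\qquad T^\pi_{dw}(Y)=\pi\,T(Y,dw).$$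
   Context: Contact triad: $Q$ is a $(2n+1)$-manifold with contact form $\lambda$, $\xi=\ker\lambda$, $X_\lambda$ the Reeb vector field, $\pi:TQ=\mathbb{R}X_\lambda\oplus\xi\to\xi$ the projection; $J$ is an endomorphism of $TQ$ with $JX_\lambda=0$, $J(\xi)=\xi$, $J^2|_\xi=-\mathrm{id}$ and $d\lambda(\cdot,J\cdot)|_\xi$ a Riemannian metric on $\xi$. $Q$ carries the triad metric $g=d\lambda(\cdot,J\cdot)+\lambda\otimes\lambda$. $\overline\partial^\pi w=\frac12(\pi dw+J\pi dw\,j)$, $\partial^\pi w=\frac12(\pi dw-J\pi dw\,j)$; for a one-form $\alpha$ on $\Sigma$, $(\alpha\circ j)(v)=\alpha(jv)$. For $\eta\in\Omega^1(w^*\xi)$ its $(0,1)$-component is $\frac12(\eta+J\eta\circ j)$. $\overline\partial^{\nabla^\pi}Y=\frac12(\nabla^\pi Y+J\nabla^\pi_{j(\cdot)}Y)$. $\Delta$ is the Laplacian on functions normalized by $d(du\circ j)=-\Delta u\,dA$ (so $\Delta u=u_{\tau\tau}+u_{tt}$ in flat isothermal coordinates). $Y^\pi\rfloor d\lambda$ denotes the one-form $v\mapsto d\lambda(Y^\pi,dw(v))$ on $\Sigma$. $\nabla$ is the contact triad connection of $(Q,\lambda,J)$ and $T$ its torsion: $\nabla$ is the unique affine connection on $Q$ such that (1) $\nabla$ is Riemannian for the triad metric; (2) $T(X_\lambda,\cdot)=0$; (3) $\nabla_{X_\lambda}X_\lambda=0$ and $\nabla_YX_\lambda\in\xi$ for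 $Y\in\xi$; (4) $\nabla^\pi:=\pi\nabla|_\xi$ is a Hermitian connection of $(\xi,d\lambda|_\xi,J)$; (5) $\pi T(JY,Y)=0$ for $Y\in\xi$; (6) $\nabla_YX_\lambda-J\nabla_{JY}X_\lambda=0$ for $Y\in\xi$. It satisfies $\nabla X_\lambda=\frac12(\mathcal L_{X_\lambda}J)J$. Linearization: for a smooth family $w_s$ with $w_0=w$, $\frac{d}{ds}|_{s=0}w_s=Y$, $D\Upsilon_1(w)(Y)$ is the covariant derivative $\nabla^\pi_s(\overline\partial^\pi w_s)|_{s=0}$ (using the pull-back of $\nabla^\pi$), and $D\Upsilon_2(w)(Y)=\frac{d}{ds}|_{s=0}d(w_s^*\lambda\circ j)$. *)

(* Defs.v *)
From HB Require Import structures.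
From mathcomp Require Import all_boot all_order all_algebra all_fingroup.
From mathcomp Require Import all_classical all_reals all_analysis.

Set Implicit Arguments.
Unset Strict Implicit.
Unset Printing Implicit Defensive.

Import Order.TTheory GRing.Theory Num.Theory numFieldNormedType.Exports.

Local Open Scope classical_set_scope.
Local Open Scope ring_scope.

Section SmoothFunctions.
Context {R : realType} {E F : normedModType R}.

(* Iterated directional derivatives exist and are continuous.  Only used with
   U open and E finite-dimensional, where this is the usual notion of C^k. *)
Fixpoint Ck (k : nat) (U : set E) (g : E -> F) : Prop :=
  (forall x, U x -> {for x, continuous g}) /\
  (if k is k'.+1 then
     forall v, (forall x, U x -> derivable g x v) /\
               Ck k' U (fun x => 'D_v g x)
   else True).

Definition smooth_on (U : set E) (g : E -> F) : Prop := forall k, Ck k U g.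

End SmoothFunctions.

(* Smooth manifold modelled on E, given by an atlas.  chart_at selects a chart
   around each point; it serves to identify the tangent space at p with E: a
   tangent vector at p is represented by its coordinates in chart_at p.  Thus
   a vector field is a function M -> E, a one-form a function M -> E -> R, ...
   No continuity of chart_at is assumed, so smoothness of such objects is
   always expressed after conversion to a fixed chart (comp and frame below). *)
Record manifold (R : realType) (E : normedModType R) := Manifold {
  pt :> topologicalType;
  chart : Type;
  ch_dom : chart -> set pt;
  ch_map : chart -> pt -> E;
  ch_inv : chart -> E -> pt;
  chart_at : pt -> chart;
  ch_dom_open : forall c, open (ch_dom c);
  ch_img_open : forall c, open (ch_map c @` ch_dom c);
  ch_mapK : forall c p, ch_dom c p -> ch_inv c (ch_map c p) = p;
  ch_map_continuous : forall c p, ch_dom c p ->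
    {for p, continuous (ch_map c)};
  ch_inv_continuous : forall c x, (ch_map c @` ch_dom c) x ->
    {for x, continuous (ch_inv c)};
  chart_atP : forall p, ch_dom (chart_at p) p;
  ch_transition : forall c c',
    smooth_on (ch_map c @` (ch_dom c `&` ch_dom c')) (ch_map c' \o ch_inv c);
  pt_hausdorff : hausdorff_space pt;
  pt_second_countable : @second_countable pt
}.

Section Calculus.
Context {R : realType} {E : normedModType R} {M : manifold E}.

(* The coordinate line through p with velocity v : T_p M. *)
Definition line (p : M) (v : E) (t : R) : M :=
  ch_inv (chart_at p) (ch_map (chart_at p) p + t *: v).

Definition velocity (gamma : R -> M) (s : R) : E :=
  derive1 (fun t => ch_map (chart_at (gamma s)) (gamma t)) s.

(* Differential of a vector-valued function. *)
Definition dfun {F : normedModType R} (f : M -> F) (p : M) (v : E) : F :=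
  derive1 (fun t => f (line p v t)) 0.

(* Components in the chart c of the tangent vector v at p. *)
Definition comp (c : chart M) (p : M) (v : E) : E := dfun (ch_map c) p v.

(* The vector field on ch_dom c with constant components v in the chart c. *)
Definition frame (c : chart M) (v : E) (p : M) : E :=
  velocity (fun t => ch_inv c (ch_map c p + t *: v)) 0.

Definition smooth_fun_on (U : set M) (f : M -> R) : Prop :=
  forall c, smooth_on (ch_map c @` (ch_dom c `&` U)) (f \o ch_inv c).

Definition smooth_vf_on (U : set M) (X : M -> E) : Prop :=
  forall c, smooth_on (ch_map c @` (ch_dom c `&` U))
    (fun x => comp c (ch_inv c x) (X (ch_inv c x))).

Definition smooth_fun_at (p : M) (f : M -> R) : Prop :=
  exists2 U, open_nbhs p U & smooth_fun_on U f.

Definition smooth_vf_at (p : M) (X : M -> E) : Prop :=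
  exists2 U, open_nbhs p U & smooth_vf_on U X.

Definition is_oneform (alpha : M -> E -> R) : Prop :=
  (forall p, scalar (alpha p)) /\
  forall c v, smooth_fun_on (ch_dom c) (fun p => alpha p (frame c v p)).

(* Endomorphism of the tangent bundle. *)
Definition is_endo (A : M -> E -> E) : Prop :=
  (forall p, linear (A p)) /\
  forall c v, smooth_vf_on (ch_dom c) (fun p => A p (frame c v p)).

(* d alpha (u, v) = U (alpha V) - V (alpha U) - alpha [U, V], computed with
   the commuting extensions U, V of u, v to coordinate vector fields. *)
Definition ext_d (alpha : M -> E -> R) (p : M) (u v : E) : R :=
  let c := chart_at p in
  dfun (fun q => alpha q (frame c v q)) p u -
  dfun (fun q => alpha q (frame c u q)) p v.

Definition bracket (X Y : M -> E) (p : M) : E :=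
  let c := chart_at p in
  dfun (fun q => comp c q (Y q)) p (X p) -
  dfun (fun q => comp c q (X q)) p (Y p).

(* (L_X A) v = [X, A V] - A [X, V], V any vector field extending v. *)
Definition lie_endo (X : M -> E) (A : M -> E -> E) (p : M) (v : E) : E :=
  let V := frame (chart_at p) v in
  bracket X (fun q => A q (V q)) p - A p (bracket X V p).

End Calculus.

Section Maps.
Context {R : realType} {E F : normedModType R}.
Context {M : manifold E} {N : manifold F}.

Definition smooth_map_on (U : set M) (f : M -> N) : Prop :=
  (forall p, U p -> {for p, continuous f}) /\
  forall c c', smooth_on
    (ch_map c @` (ch_dom c `&` U `&` f @^-1` ch_dom c'))
    (ch_map c' \o f \o ch_inv c).

Definition dmap (f : M -> N) (p : M) (v : E) : F :=
  velocity (fun t => f (line p v t)) 0.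

(* Y is a smooth section of f^* TN. *)
Definition smooth_along (f : M -> N) (Y : M -> F) : Prop :=
  forall c c', smooth_on
    (ch_map c @` (ch_dom c `&` f @^-1` ch_dom c'))
    (fun x => comp c' (f (ch_inv c x)) (Y (ch_inv c x))).

(* W is a smooth family of maps U -> N (s in a neighbourhood of 0) through
   f|_U with derivative Y|_U.  For U = setT these are the smooth families of
   maps M -> N; the linearization at a point only depends on the germ of the
   family there, and over small U suitable families exist for every Y. *)
Definition is_variation (f : M -> N) (Y : M -> F) (U : set M)
    (W : R -> M -> N) : Prop :=
  [/\ exists2 e : R, 0 < e &
        (forall s p, `|s| < e -> U p ->
           {for (s, p), continuous (fun q : R * M => W q.1 q.2)}) /\
        forall c c', smooth_on
          [set q : R * E | [/\ `|q.1| < e, (ch_map c @` (ch_dom c `&` U)) q.2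
                             & ch_dom c' (W q.1 (ch_inv c q.2))]]
          (fun q : R * E => ch_map c' (W q.1 (ch_inv c q.2))),
      forall p, U p -> W 0 p = f p
    & forall p, U p -> velocity (fun s => W s p) 0 = Y p].

End Maps.

Section Connections.
Context {R : realType} {E : normedModType R} {M : manifold E}.
Implicit Types (nabla : M -> E -> (M -> E) -> E) (X Y V : M -> E).

(* nabla p v X is the covariant derivative at p of X in the direction v.
   X ranges over vector fields smooth near p (the values for other X are
   irrelevant).  Locality is a consequence of the Leibniz rule, applied to
   indicator functions of neighbourhoods. *)
Definition is_connection nabla : Prop :=
  [/\ forall p X, smooth_vf_at p X -> linear (fun v => nabla p v X),
      forall p v X Y, smooth_vf_at p X -> smooth_vf_at p Y ->
        nabla p v (fun q => X q + Y q) = nabla p v X + nabla p v Y,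
      forall p v (f : M -> R) X, smooth_fun_at p f -> smooth_vf_at p X ->
        nabla p v (fun q => f q *: X q) =
          dfun f p v *: X p + f p *: nabla p v X
    & forall (U : set M) V X, open U -> smooth_vf_on U V ->
        smooth_vf_on U X -> smooth_vf_on U (fun p => nabla p (V p) X)].

(* T(u, v) = nabla_U V - nabla_V U - [U, V] for extensions U, V of u, v. *)
Definition torsion nabla (p : M) (u v : E) : E :=
  let U := frame (chart_at p) u in let V := frame (chart_at p) v in
  nabla p u V - nabla p v U - bracket U V p.

(* Covariant derivative of the vector field V along the curve gamma: in a
   chart with coordinate fields e_i, if V = V^i e_i, it is
   (dV^i/ds) e_i + V^i nabla_(gamma') e_i. *)
Definition cov_curve nabla (gamma : R -> M) (V : R -> E) (s : R) : E :=
  let c := chart_at (gamma s) in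
  derive1 (fun t => comp c (gamma t) (V t)) s +
  nabla (gamma s) (velocity gamma s) (frame c (V s)).

(* Pull-back connection on f^* TM: nabla_v Y. *)
Definition cov_along nabla {F : normedModType R} {S : manifold F}
    (f : S -> M) (Y : S -> E) (z : S) (v : F) : E :=
  cov_curve nabla (fun t => f (line z v t)) (fun t => Y (line z v t)) 0.

End Connections.

Section ContactTriads.
Context {R : realType} {n : nat}.
Local Notation E := 'rV[R]_(n.*2.+1).
Context {Q : manifold E}.
Variables (lam : Q -> E -> R) (J : Q -> E -> E) (X : Q -> E).

(* Up to a positive constant, the sum below is
   (lam /\ (d lam)^n)(v_0, ..., v_2n). *)
Definition is_contact_form : Prop :=
  is_oneform lam /\
  forall p, exists v : 'I_(n.*2.+1) -> E,
    \sum_(s : 'S_(n.*2.+1))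
      (-1) ^+ s * lam p (v (s ord0)) *
      \prod_(i < n) ext_d lam p (v (s (inord i.*2.+1)))
                                (v (s (inord i.*2.+2))) != 0.

Definition is_reeb : Prop :=
  [/\ smooth_vf_on setT X,
      forall p, lam p (X p) = 1
    & forall p v, ext_d lam p (X p) v = 0].

Definition proj_xi (p : Q) (v : E) : E := v - lam p v *: X p.

Definition triad_metric (p : Q) (u v : E) : R :=
  ext_d lam p u (J p v) + lam p u * lam p v.

Record contact_triad : Prop := ContactTriad {
  triad_contact : is_contact_form;
  triad_reeb : is_reeb;
  triad_J : is_endo J;
  triad_J_reeb : forall p, J p (X p) = 0;
  triad_J_xi : forall p, J p @` [set v | lam p v = 0] = [set v | lam p v = 0];
  triad_J_sq : forall p v, lam p v = 0 -> J p (J p v) = - v;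
  triad_metric_sym : forall p u v, lam p u = 0 -> lam p v = 0 ->
    ext_d lam p u (J p v) = ext_d lam p v (J p u);
  triad_metric_pos : forall p v, lam p v = 0 -> v != 0 ->
    0 < ext_d lam p v (J p v)
}.

Variable nabla : Q -> E -> (Q -> E) -> E.

Definition nabla_pi (p : Q) (v : E) (Y : Q -> E) : E :=
  proj_xi p (nabla p v Y).

(* Y is a smooth section of xi near p. *)
Definition xi_section_at (p : Q) (Y : Q -> E) : Prop :=
  smooth_vf_at p Y /\ \forall q \near p, lam q (Y q) = 0.

Record triad_connection : Prop := TriadConnection {
  tc_connection : is_connection nabla;
  tc_metric : forall p v Y Z, smooth_vf_at p Y -> smooth_vf_at p Z ->
    dfun (fun q => triad_metric q (Y q) (Z q)) p v =
      triad_metric p (nabla p v Y) (Z p) + triad_metric p (Y p) (nabla p v Z);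
  tc_torsion_reeb : forall p v, torsion nabla p (X p) v = 0;
  tc_geodesic : forall p, nabla p (X p) X = 0;
  tc_reeb_xi : forall p v, lam p v = 0 -> lam p (nabla p v X) = 0;
  tc_hermitian_J : forall p v Y, xi_section_at p Y ->
    nabla_pi p v (fun q => J q (Y q)) = J p (nabla_pi p v Y);
  tc_hermitian_metric : forall p v Y Z,
    xi_section_at p Y -> xi_section_at p Z ->
    dfun (fun q => ext_d lam q (Y q) (J q (Z q))) p v =
      ext_d lam p (nabla_pi p v Y) (J p (Z p)) +
      ext_d lam p (Y p) (J p (nabla_pi p v Z));
  tc_torsion_J : forall p v, lam p v = 0 ->
    proj_xi p (torsion nabla p (J p v) v) = 0;
  tc_reeb_J : forall p v, lam p v = 0 ->
    nabla p v X - J p (nabla p (J p v) X) = 0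
}.

End ContactTriads.

Section Surfaces.
Context {R : realType}.
Local Notation E := 'rV[R]_2.

(* In real dimension two every almost complex structure is integrable. *)
Definition is_complex_structure {S : manifold E} (j : S -> E -> E) : Prop :=
  is_endo j /\ forall z v, j z (j z v) = - v.

(* (S, j) is biholomorphic to the complement of a finite set P in a closed
   Riemann surface (C, jC); S is closed if P is empty. *)
Definition closed_or_punctured (S : manifold E) (j : S -> E -> E) : Prop :=
  exists (C : manifold E) (jC : C -> E -> E) (P : set C)
         (f : S -> C) (g : C -> S),
    [/\ is_complex_structure jC, compact [set: C] & finite_set P] /\
    [/\ smooth_map_on setT f, smooth_map_on (~` P) g,
        forall z, (~` P) (f z) /\ g (f z) = z,
        forall p, (~` P) p -> f (g p) = p
      & forall z v, dmap f z (j z v) = jC (f z) (dmap f z v)].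

Context {S : manifold E}.
Variables (j : S -> E -> E) (h : S -> E -> E -> R).

(* The Kaehler form is a 2-form on a surface, hence closed. *)
Definition is_kaehler_metric : Prop :=
  [/\ forall z u, scalar (h z u),
      forall z u v, h z u v = h z v u,
      forall z v, v != 0 -> 0 < h z v v,
      forall z u v, h z (j z u) (j z v) = h z u v
    & forall c u v, smooth_fun_on (ch_dom c)
        (fun z => h z (frame c u z) (frame c v z))].

Definition area_form (z : S) (u v : E) : R := h z (j z u) v.

Definition grad (u : S -> R) (z : S) : E :=
  (\row_i dfun u z (delta_mx 0 i)) *m
  invmx (\matrix_(i, k) h z (delta_mx 0 i) (delta_mx 0 k)).

(* L_G dA = d (iota_G dA) = (div G) dA. *)
Definition divergence (G : S -> E) (z : S) : R :=
  ext_d (fun q => area_form q (G q)) z (delta_mx 0 0) (delta_mx 0 1) /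
  area_form z (delta_mx 0 0) (delta_mx 0 1).

(* Laplace-Beltrami operator of h; in isothermal coordinates with h flat it
   is u_tautau + u_tt, i.e. d (du o j) = - (laplacian u) dA. *)
Definition laplacian (u : S -> R) (z : S) : R := divergence (grad u) z.

End Surfaces.

Section CauchyRiemann.
Context {R : realType} {n : nat}.
Local Notation E := 'rV[R]_(n.*2.+1).
Context {Q : manifold E} {S : manifold 'rV[R]_2}.
Variables (lam : Q -> E -> R) (J : Q -> E -> E) (X : Q -> E).
Variables (nabla : Q -> E -> (Q -> E) -> E) (j : S -> 'rV[R]_2 -> 'rV[R]_2).
Implicit Types (w : S -> Q) (Y : S -> E) (eta : S -> 'rV[R]_2 -> E)
  (W : R -> S -> Q) (z : S) (u v : 'rV[R]_2).

Definition part01 w eta z v : E :=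
  2^-1 *: (eta z v + J (w z) (eta z (j z v))).

Definition dpi w z v : E := proj_xi lam X (w z) (dmap w z v).

Definition dbar_pi w z v : E :=
  2^-1 *: (dpi w z v + J (w z) (dpi w z (j z v))).

Definition del_pi w z v : E :=
  2^-1 *: (dpi w z v - J (w z) (dpi w z (j z v))).

Definition pullback_lam w z v : R := lam (w z) (dmap w z v).

Definition Upsilon1 w z v : E := dbar_pi w z v.

Definition Upsilon2 w z u v : R :=
  ext_d (fun q x => pullback_lam w q (j q x)) z u v.

(* The linearizations of Upsilon1 and Upsilon2 along the family W. *)
Definition DUpsilon1 W z v : E :=
  proj_xi lam X (W 0 z)
    (cov_curve nabla (fun s => W s z) (fun s => Upsilon1 (W s) z v) 0).

Definition DUpsilon2 W z u v : R :=
  derive1 (fun s => Upsilon2 (W s) z u v) 0.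

Definition nabla_pi_along w Y z v : E :=
  proj_xi lam X (w z) (cov_along nabla w Y z v).

Definition dbar_nabla_pi w Y z v : E :=
  2^-1 *: (nabla_pi_along w Y z v + J (w z) (nabla_pi_along w Y z (j z v))).

Definition sec_pi w Y z : E := proj_xi lam X (w z) (Y z).

Definition sec_lam w Y z : R := lam (w z) (Y z).

Definition T_pi w Y z v : E :=
  proj_xi lam X (w z) (torsion nabla (w z) (Y z) (dmap w z v)).

Definition B_op w Y z v : E :=
  - (2^-1 * pullback_lam w z v) *:
    lie_endo X J (w z) (J (w z) (Y z)).

(* The one-form Y _| d lam on S. *)
Definition contract_dlam w Y z v : R :=
  ext_d lam (w z) (Y z) (dmap w z v).

End CauchyRiemann.

(* Main.v *)
(* Both formulas are computed in a single chart around w z, in which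
   F (s, y) is the local expression of the family W.

   First formula: in coordinates nabla is a directional derivative plus a
   bilinear Christoffel term, so nabla_s (dw_s v) and nabla_v Y differ by
   the torsion because the mixed second derivatives of F agree.  Projecting
   to xi produces the terms in nabla X.  Since T (X, .) = 0, [L_X J] is the
   commutator of J with nabla X, and the axioms of the triad connection turn
   this into nabla X = (L_X J) J / 2 on xi.

   Second formula: by Cartan's formula the derivative of w_s^* lam is
   Y _| d lam + d (lam Y), and X _| d lam = 0.  It commutes with the exterior
   derivative of w_s^* lam o j by symmetry of second derivatives, and
   d (du o j) = - (laplacian u) dA because grad u _| dA = - du o j. *)
Require Import Defs.
From HB Require Import structures.
From mathcomp Require Import all_boot all_order all_algebra all_fingroup.
From mathcomp Require Import all_classical all_reals all_analysis.
From mathcomp Require Import ring lra.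
(* Again, since [ssrfun.comp] would hide the components [comp] of a vector. *)
Import Defs.

Set Implicit Arguments.
Unset Strict Implicit.
Unset Printing Implicit Defensive.

Import Order.TTheory GRing.Theory Num.Theory numFieldNormedType.Exports.

Local Open Scope classical_set_scope.
Local Open Scope ring_scope.

(** * Calculus of C^k maps between finite-dimensional spaces *)

(** Two features of the definitions shape the work. [Ck] speaks of directional derivatives only,
    while every change of chart needs the chain rule; Frechet differentiability of C^1 maps is
    therefore first derived from the mean value theorem, one scalar component at a time. And a
    tangent vector at [q] is stored in the chart [chart_at q], which may jump with [q]: a field
    along a curve is never differentiated as it stands, but through its components [comp] in one
    fixed chart, [frame] being the way back. In coordinates the derivative of [V - lam V *: X]
    contains a multiple of [X] that is of no interest. Such derivatives are carried as existential
    witnesses [D], of which only the projection to xi of [D] plus its Christoffel term is recorded.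
    The factor 1/2 in front of [(L_X J) J] comes from the sixth axiom: on xi it makes nabla X
    anticommute with J, so that the two terms of the commutator coincide. The Laplacian is defined
    as divergence of gradient, so its relation to [d (df o j)] needs the Gram matrix of [h] to be
    invertible and the area form to be nonzero. *)

Section FiniteDimension.
Context {R : realType}.

(** The vectors [e] span and the continuous functionals [a] are coefficients; independence is not
    asked for. This suffices to reduce vector values to scalars and varying directions to finitely
    many fixed ones. *)
Class finite_dim (E : normedModType R) : Prop := finite_dimP :
  exists (m : nat) (e : 'I_m -> E) (a : 'I_m -> {linear E -> R}),
    (forall i, continuous (a i)) /\ forall x, x = \sum_i a i x *: e i.

Lemma scalar_finite_dim : finite_dim R.
Proof.
exists 1, (fun=> 1), (fun=> idfun); split=> [i x|x]; first exact: cvg_id.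
by rewrite big_ord1 /= [_ *: _]mulr1.
Qed.

Lemma row_finite_dim m : finite_dim 'rV[R]_m.
Proof.
have lin i : linear (fun x : 'rV[R]_m => x 0 i : R) by move=> k u v;
  rewrite !mxE.
pose a i : {linear 'rV[R]_m -> R} :=
  HB.pack (fun x : 'rV[R]_m => x 0 i : R) (GRing.isLinear.Build _ _ _ _ _ (lin
    i)).
exists m, (delta_mx 0), a.
split=> [i x|x]; last exact: row_sum_delta.
exact/differentiable_continuous/differentiable_coord.
Qed.

Lemma prod_finite_dim (E F : normedModType R) :
  finite_dim E -> finite_dim F -> finite_dim (E * F)%type.
Proof.
move=> [m [e [a [ac aE]]]] [n [f [b [bc bE]]]].
pose g (i : 'I_m + 'I_n) : (E * F)%type :=
  match i with inl i => (e i, 0) | inr i => (0, f i) end.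
pose c (i : 'I_m + 'I_n) : {linear (E * F)%type -> R} :=
  match i with inl i => a i \o fst | inr i => b i \o snd end.
exists (m + n)%N, (fun i => g (fintype.split i)), (fun i =>
  c (fintype.split i)).
split=> [i p|[x y]].
  rewrite /=; case: (fintype.split i) => k /=.
  - by apply: (continuous_comp cvg_fst); exact: ac.
  - by apply: (continuous_comp cvg_snd); exact: bc.
rewrite big_split_ord /=.
under eq_bigr do rewrite (unsplitK (inl _)) /=.
under [X in _ + X]eq_bigr do rewrite (unsplitK (inr _)) /=.
rewrite [LHS]surjective_pairing.
transitivity ((x, 0) + (0, y) : (E * F)%type).
  by congr pair; rewrite /= ?addr0 ?add0r.
congr (_ + _).
  rewrite {1}[x]aE.
  elim/big_ind2 : _ => // [x1 x2 y1 y2|i _].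
    by move=> <- <-; congr pair; rewrite /= addr0.
  by congr pair; rewrite /= scaler0.
rewrite {1}[y]bE.
elim/big_ind2 : _ => // [x1 x2 y1 y2|i _].
  by move=> <- <-; congr pair; rewrite /= addr0.
by congr pair; rewrite /= scaler0.
Qed.

End FiniteDimension.

#[local] Existing Instances scalar_finite_dim row_finite_dim prod_finite_dim.

(** * Mean value estimates *)

Section MeanValue.
Context {R : realType} {E : normedModType R}.
Implicit Types (f : E -> R) (x y v e : E).

Lemma is_derive_line {F : normedModType R} (f : E ->
  F) x e (t : R) : derivable f (t *: e + x) e ->
  is_derive t 1 (fun s : R => f (s *: e + x)) ('D_e f (t *: e + x)).
Proof.
have E1 : (fun h : R => h^-1 *: (((fun s : R => f (s *: e + x)) \o shift t) (h
  *: 1) - f (t *: e + x)))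
   = (fun h => h^-1 *: ((f \o shift (t *: e + x)) (h *: e) - f (t *: e + x))).
  by apply/funext => h /=; rewrite [_%:A]mulr1 scalerDl addrA.
by move=> df; split; rewrite /derivable /derive E1.
Qed.

Lemma MVT_sym (f df : R -> R) (t : R) : (forall s : R, `|s| <= `|t| ->
  is_derive s 1 f (df s)) ->
  exists2 s, `|s| <= `|t| & f t - f 0 = df s * t.
Proof.
move=> fd.
have fc (a b : R) : `|a| <= `|t| -> `|b| <= `|t| ->
  {within `[a, b], continuous f}.
  move=> al bl; apply: derivable_within_continuous => s;
    rewrite in_itv /= => /andP[as_ sb].
  have : `|s| <= `|t| by move: al bl; rewrite !ler_norml; lra.
  by move/fd => [].
have [t0|/ltW t0] := leP 0 t.
  have [||s] := @MVT_segment _ f df 0 t t0.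
  - move=> x; rewrite in_itv /= => /andP[? ?]; by apply: fd;
    rewrite !ger0_norm //; lra.
  - by apply: fc; rewrite ?normr0.
  rewrite in_itv /= subr0 => /andP[? ?] ->; exists s => //.
  by rewrite !ger0_norm.
have [||s] := @MVT_segment _ f df t 0 t0.
- move=> x; rewrite in_itv /= => /andP[? ?]; by apply: fd;
  rewrite !ler0_norm //; lra.
- by apply: fc; rewrite ?normr0.
rewrite in_itv /= sub0r => /andP[? ?] H; exists s => //.
  by rewrite !ler0_norm // lerN2.
by rewrite -opprB H mulrN opprK.
Qed.

(** The base point [y] is free to move near [x]: this uniformity lets the increments along
    successive coordinates be added up in [partial_increment]. *)
Lemma directional_increment f x e (eps : R) :
  (\forall y \near x, derivable f y e) ->
  {for x, continuous ('D_e f)} -> 0 < eps ->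
  exists2 d : R, 0 < d & forall y (t : R), `|y - x| < d -> `|t| < d ->
    `|f (t *: e + y) - f y - t * 'D_e f x| <= eps * `|t|.
Proof.
move=> fd fc eps0.
have : \forall y \near x, derivable f y e /\ `|'D_e f x - 'D_e f y| <= eps.
  near=> y; split; first by near: y.
  by near: y; move/cvgrPdist_le : fc; apply.
move=> /nbhs_normP[d0 d00 H].
(* With this [d], the whole segment from [y] to [t *: e + y] stays within [d * |e| + d = d0] of
   [x]. *)
pose d := d0 / (1 + `|e|).
have e0 : 0 < 1 + `|e| by rewrite ltr_pwDl.
exists d => [|y t yd td]; first exact: divr_gt0.
have D s : `|s| <= `|t| -> derivable f (s *: e + y) e /\
    `|'D_e f x - 'D_e f (s *: e + y)| <= eps.
  move=> st; apply: H => /=.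
  rewrite distrC -addrA (le_lt_trans (ler_normD _ _)) // normrZ.
  have -> : d0 = d * `|e| + d by rewrite /d; field; rewrite gt_eqF.
  by rewrite ler_ltD // ler_wpM2r // (le_trans st) // ltW.
have [|s /D[_ sd]] := @MVT_sym (fun s => f (s *: e + y))
    (fun s => 'D_e f (s *: e + y)) t.
  by move=> s /D[ds _]; exact: is_derive_line.
rewrite scale0r add0r => ->; rewrite [t * _]mulrC -mulrBl normrM.
by rewrite ler_wpM2r // distrC.
Unshelve. all: by end_near. Qed.
End MeanValue.

Lemma continuous_near_eq {T U : topologicalType} (f g : T -> U) x :
  (\near x, f x = g x) -> {for x, continuous f} -> {for x, continuous g}.
Proof.
move=> fg fc; rewrite /prop_for /continuous_at -(nbhs_singleton fg).
apply: cvg_trans fc; apply: near_eq_cvg.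
by apply: filterS fg => y ->.
Qed.

(** * C^1 maps are Frechet differentiable *)

Section C1Differentiable.
Context {R : realType} {E : normedModType R}.

(** Induction on the list of coordinates. The step along [e i] starts from [s + x], where [s]
    collects the remaining coordinates and tends to 0 with [h], so [directional_increment] applies
    there; it and the induction hypothesis each use half of [eps]. *)
Lemma partial_increment (f : E -> R) x m (e : 'I_m -> E)
    (a : 'I_m -> {linear E -> R}) :
  (forall i, continuous (a i)) ->
  (forall i, \forall y \near x, derivable f y (e i)) ->
  (forall i, {for x, continuous ('D_(e i) f)}) ->
  forall (r : seq 'I_m) (eps : R), 0 < eps -> \forall h \near (0 : E),
    `|f (\sum_(i <- r) a i h *: e i + x) - f x
      - \sum_(i <- r) a i h * 'D_(e i) f x| <= eps * `|h|.
Proof.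
move=> ac fd fc; elim=> [|i r IH] eps eps0.
  near=> h; rewrite !big_nil add0r subrr subr0 normr0.
  by rewrite mulr_ge0 // ltW.
have [C C0 aC] := linear_lipschitz (ac i).
have eps20 : 0 < eps / 2 by rewrite divr_gt0.
(* [C] is a Lipschitz constant of [a i]; dividing by it turns a bound in [|a i h|] into one in
   [|h|]. *)
have epsC0 : 0 < eps / 2 / C by rewrite divr_gt0.
have [d d0 H] := directional_increment (fd i) (fc i) epsC0.
near=> h; rewrite !big_cons -[X in f X]addrA.
set s := \sum_(k <- r) a k h *: e k; set t := \sum_(k <- r) _ * _.
rewrite [X in `|X|](_ : _ = (f (a i h *: e i + (s + x)) - f (s + x) -
  a i h * 'D_(e i) f x) + (f (s + x) - f x - t)); last by ring.
rewrite [eps]splitr mulrDl (le_trans (ler_normD _ _)) // lerD //; last first.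
  by rewrite /s /t; near: h; exact: IH.
apply: (@le_trans _ _ (eps / 2 / C * `|a i h|)); last first.
  by rewrite -mulrA ler_wpM2l ?(ltW eps20) // ler_pdivrMl.
apply: H.
  rewrite addrK /s; near: h.
  have : (fun h => \sum_(k <- r) a k h *: e k) @ (0 : E) --> (0 : E).
    rewrite [X in _ --> X](_ : _ = \sum_(k <- r) a k 0 *: e k).
      by apply: cvg_big; [exact: add_continuous|] => k _; apply: cvgZr_tmp;
        exact: ac.
    by rewrite big1 // => k _; rewrite linear0 scale0r.
  by move/cvgr0_norm_lt; apply.
near: h; have : a i h @[h --> (0 : E)] --> (0 : R).
  by rewrite -(linear0 (a i)); exact: ac.
by move/cvgr0_norm_lt; apply.
Unshelve. all: by end_near. Qed.

Lemma is_diff_of_increment (F : normedModType R) (f : E -> F) x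
    (L : {linear E -> F}) : continuous L ->
  (forall eps : R, 0 < eps -> \forall h \near (0 : E),
    `|f (h + x) - f x - L h| <= eps * `|h|) ->
  differentiable f x.
Proof.
move=> Lc H.
have HL : f \o shift x = cst (f x) + L +o_ 0 id.
  apply/eqaddoP => eps eps0; near=> h.
  rewrite [X in `|X|](_ : _ = f (h + x) - f x - L h); last first.
    by rewrite opprD addrA.
  by near: h; exact: H.
by apply/diff_locallyP; rewrite (diff_unique Lc HL).
Unshelve. all: by end_near. Qed.

Context {fE : finite_dim E}.

Lemma C1_scalar_differentiable (f : E -> R) x :
  (forall v, \forall y \near x, derivable f y v) ->
  (forall v, {for x, continuous ('D_v f)}) ->
  differentiable f x.
Proof.
move=> fd fc; have [m [e [a [ac aE]]]] := fE.
pose L h := \sum_i a i h * 'D_(e i) f x.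
have Llin : linear L.
  move=> k u v; rewrite /L scaler_sumr -big_split; apply: eq_bigr => i _.
  by rewrite linearP /= mulrDl; congr (_ + _); exact: esym (mulrA _ _ _).
pose LM := GRing.isLinear.Build _ _ _ _ _ Llin.
pose LL : {linear E -> R} := HB.pack L LM.
apply: (@is_diff_of_increment _ _ _ LL).
  move=> h; apply: cvg_big; [exact: add_continuous|] => i _; apply: cvgMr_tmp;
    exact: ac.
move=> eps eps0; near=> h.
rewrite {1}[h]aE; near: h.
exact: (partial_increment ac (fun i => fd (e i)) (fun i => fc (e i))).
Unshelve. all: by end_near. Qed.

Lemma derive_linear_comp (F G : normedModType R) (a : {linear F -> G})
   (f : E -> F) x v : continuous a -> derivable f x v ->
  is_derive x v (a \o f) (a ('D_v f x)).
Proof.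
move=> ac fd.
have H : h^-1 *: (((a \o f) \o shift x) (h *: v) - (a \o f) x) @[h --> (0:R)^']
  -->
   a ('D_v f x).
  rewrite [X in X @ _](_ : _ = a \o (fun h : R =>
    h^-1 *: ((f \o shift x) (h *: v) - f x))).
    exact: (cvg_comp _ _ fd (ac _)).
  by apply/funext => h /=; rewrite -linearB linearZ. 
by split; [apply/cvg_ex; eexists; exact: H|exact: cvg_lim H].
Qed.

(** The bridge from the directional derivatives in [Ck] to the differential required by the chain
    rule; each component [a i \o f] is a scalar C^1 function. *)
Lemma C1_differentiable (F : normedModType R) {fF : finite_dim F} (f : E ->
  F) x :
  (forall v, \forall y \near x, derivable f y v) ->
  (forall v, {for x, continuous ('D_v f)}) ->
  differentiable f x.
Proof.
move=> fd fc; have [m [e [a [ac aE]]]] := fF.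
have -> : f = \sum_i (fun y => a i (f y) *: e i).
  by apply/funext => y; rewrite fct_sumE -aE.
apply: differentiable_sum => i; apply: differentiableZl.
apply: C1_scalar_differentiable => v.
  near=> y.
  have /(derive_linear_comp (ac i)) [] // : derivable f y v by near: y;
    exact: fd.
have H : {near x, 'D_v (a i \o f) =1 a i \o 'D_v f}.
  near=> y.
  have /(derive_linear_comp (ac i)) [] // : derivable f y v by near: y;
    exact: fd.
apply: (continuous_near_eq (f := a i \o 'D_v f)).
  by apply: filterS H => y ->.
by apply: continuous_comp; [exact: fc|exact: ac].
Unshelve. all: by end_near. Qed.

End C1Differentiable.

Lemma derive1_at0 {R : realType} {E F : normedModType R} (g : E -> F) x v :
  derive1 (fun t : R => g (x + t *: v)) 0 = 'D_v g x.
Proof.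
rewrite /derive1 /derive; set d := (fun _ : R => _); set d' := (fun _ : R => _).
suff -> : d = d' by [].
by apply/funext => h; rewrite /d /d' /= scale0r !addr0 [x + _]addrC.
Qed.

(** * Partial derivatives on a product, and the chain rule *)

Section PartialDerivatives.
Context {R : realType} {E F : normedModType R}.

Lemma derive_snd (f : R * E -> F) s y v :
  'D_v (fun y => f (s, y)) y = 'D_(0, v) f (s, y).
Proof.
rewrite /derive; set d := (fun _ : R => _); set d' := (fun _ : R => _).
suff -> : d = d' by [].
apply/funext => h; rewrite /d /d' /=.
rewrite [h *: (0, v) + (s, y)](_ : _ = (s, h *: v + y)) //.
by congr pair; rewrite /= ?scaler0 ?add0r.
Qed.

Lemma derive_fst (f : R * E -> F) s y :
  'D_1 (fun s => f (s, y)) s = 'D_(1, 0) f (s, y).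
Proof.
rewrite /derive; set d := (fun _ : R => _); set d' := (fun _ : R => _).
suff -> : d = d' by [].
apply/funext => h; rewrite /d /d' /=.
rewrite [h *: (1, 0) + (s, y)](_ : _ = (h *: 1 + s, y)) //.
by congr pair; rewrite /= ?scaler0 ?add0r.
Qed.

Lemma differentiable_fix_fst (f : R * E -> F) s y : differentiable f (s, y) ->
  differentiable (fun y => f (s, y)) y.
Proof.
move=> fd; apply: (differentiable_comp (f := fun y => (s, y))).
  by apply: differentiable_pair; [exact: differentiable_cst|exact: ex_diff].
exact: fd.
Qed.

Lemma differentiable_fix_snd (f : R * E -> F) s y : differentiable f (s, y) ->
  differentiable (fun s => f (s, y)) s.
Proof.
move=> fd; apply: (differentiable_comp (f := fun s => (s, y))).
  by apply: differentiable_pair; [exact: ex_diff|exact: differentiable_cst].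
exact: fd.
Qed.

End PartialDerivatives.

Section ChainRule.
Context {R : realType} {E F G : normedModType R}.

Lemma derive_comp (f : E -> F) (g : F -> G) x v :
  differentiable f x -> differentiable g (f x) ->
  'D_v (g \o f) x = 'D_('D_v f x) g (f x).
Proof.
move=> df dg; have dgf := differentiable_comp df dg.
by rewrite (deriveE v dgf) (deriveE v df) (deriveE _ dg) diff_comp.
Qed.

Lemma derive_dir_linear (f : E -> F) x :
  differentiable f x -> linear (fun v => 'D_v f x).
Proof. by move=> df k u v; rewrite 3!(deriveE _ df) linearP. Qed.

Lemma differentiable_near_eq (f g : E -> F) x : (\near x, f x = g x) ->
  differentiable f x -> differentiable g x.
Proof.
move=> fg df; have dfc : continuous ('d f x) by exact: diff_continuous.
apply: (@is_diff_of_increment _ _ _ _ _ ('d f x)) => // eps eps0.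
have /eqaddoP/(_ eps eps0) := diff_locally df.
have fg0 : \forall h \near (0:E), f (h + x) = g (h + x).
  by move: fg; rewrite (near_shift 0) subr0.
apply: filterS2 fg0 => h /= <-; rewrite -(nbhs_singleton fg).
by rewrite [X in `|X| <= _ -> _](_ : _ = f (h + x) - f x - 'd f x h) //= opprD
  addrA.
Qed.

End ChainRule.

(** * Symmetry of second derivatives *)

Section Schwarz.
Context {R : realType} {E : normedModType R}.

(** The mean value theorem for [t |-> f (t u + s v + x) - f (t u + x)] yields a difference of values
    of ['D_u f], which the differential of ['D_u f] at [x] then evaluates. Only ['D_u f] has to be
    differentiable, so the lemma can be used again with [u] and [v] exchanged. *)
Lemma second_increment (f : E -> R) x u v (eps : R) :
  (\forall y \near x, derivable f y u) -> differentiable ('D_u f) x ->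
  0 < eps -> \forall s \near (0 : R),
  `|(f (s *: u + (s *: v + x)) - f (s *: u + x)) - (f (s *: v + x) - f x)
    - s ^+ 2 * 'D_v ('D_u f) x| <= eps * s ^+ 2.
Proof.
move=> fd dd eps0.
(* ['D_u f] is expanded at [t u + s v] and at [t u] with [|t| <= |s|]; the two errors add up to a
   multiple of [|s| * (|u| + |v| + |u|)], and the 1 keeps [C] positive. *)
pose C := `|u| + `|v| + `|u| + 1.
have C0 : 0 < C by rewrite ltr_wpDl.
have /eqaddoP/(_ _ (divr_gt0 eps0 C0)) H := diff_locally dd.
have fd0 : \forall h \near (0:E), derivable f (h + x) u.
  by move: fd; rewrite (near_shift 0) subr0.
have : \forall h \near (0 : E), derivable f (h + x) u /\
  `|'D_u f (h + x) - 'D_u f x - 'd ('D_u f) x h| <= eps / C * `|h|.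
  near=> h; split; first by near: h.
  rewrite [X in `|X|](_ : _ = ('D_u f \o shift x) h - (cst ('D_u f x) + 'd ('D_u
    f) x) h).
    by near: h.
  by rewrite /= opprD addrA.
move=> /nbhs_normP[d /= d0]; rewrite /ball_ => {}H.
have s0 : \forall s \near (0 : R), `|s| < d / C.
  by apply: (@cvgr0_norm_lt _ _ _ (nbhs (0:R)) _ id) => //; exact: divr_gt0.
near=> s.
have sd : `|s| * C < d.
  by rewrite -ltr_pdivlMr //; near: s.
have small t (w : E) : `|t| <= `|s| -> w = 0 \/ w = s *: v ->
  `|0 - (t *: u + w)| < d.
  move=> ts wE; rewrite sub0r normrN; apply: le_lt_trans sd.
  rewrite (le_trans (ler_normD _ _)) // normrZ /C.
  have wb : `|w| <= `|s| * `|v|.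
    by case: wE => ->; rewrite ?normrZ // normr0 mulr_ge0.
  have tu := ler_wpM2r (normr_ge0 u) ts.
  have su : 0 <= `|s| * `|u| by rewrite mulr_ge0.
  have := normr_ge0 s; lra.
have [|t ts] := @MVT_sym R (fun t => f (t *: u + (s *: v + x)) - f (t *: u + x))
   (fun t => 'D_u f (t *: u + (s *: v + x)) - 'D_u f (t *: u + x)) s.
  move=> t ts; apply: is_deriveB; apply: is_derive_line.
    by rewrite addrA; apply: (H _ _).1; apply: small; [|right].
  by rewrite -[t *: u]addr0; apply: (H _ _).1; apply: small; [|left].
rewrite scale0r !add0r => ->.
have := (H _ (small t 0 ts (or_introl erefl))).2.
have := (H _ (small t (s *: v) ts (or_intror erefl))).2.
rewrite addr0 addrA (deriveE v dd) linearD ['d _ _ (s *: v)]linearZ /=.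
set a := 'D_u f _; set b := 'D_u f x; set c := 'd _ _ _; set e := 'd _ _ _;
  set a' := 'D_u f _.
move=> H1 H2.
rewrite [X in `|X|](_ : _ = s * ((a - b - (c + s *: e)) - (a' - b - c)));
  last first.
  by rewrite /GRing.scale /=; ring.
rewrite normrM.
have s2 : s ^+ 2 = `|s| * `|s| by rewrite -expr2 real_normK ?num_real.
suff H3 : `|a - b - (c + s *: e) - (a' - b - c)| <= eps * `|s|.
  by rewrite s2 mulrCA ler_wpM2l.
rewrite (le_trans (ler_normB _ _)) // (le_trans (lerD H1 H2)) // -mulrDr.
have -> : eps * `|s| = eps / C * (`|s| * C) by field; rewrite gt_eqF.
rewrite ler_wpM2l ?(ltW (divr_gt0 eps0 C0)) //.
have tu : `|t *: u| <= `|s| * `|u| by rewrite normrZ ler_wpM2r.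
rewrite (le_trans (lerD (ler_normD _ _) tu)) // [`|s *: v|]normrZ.
have su : 0 <= `|s| * `|u| by rewrite mulr_ge0.
have := normr_ge0 s; rewrite /C; lra.
Unshelve. all: by end_near. Qed.

(** The second difference over the parallelogram spanned by [s u] and [s v] is symmetric in [u] and
    [v], and after division by [s ^+ 2] it is within [eps / 2] of either mixed derivative. *)
Lemma schwarz_scalar (f : E -> R) x u v :
  (\forall y \near x, derivable f y u) -> (\forall y \near x,
    derivable f y v) ->
  differentiable ('D_u f) x -> differentiable ('D_v f) x ->
  'D_v ('D_u f) x = 'D_u ('D_v f) x.
Proof.
move=> fu fv du dv; apply/eqP; rewrite -subr_eq0 -normr_le0.
apply/ler_addgt0Pr => eps eps0; rewrite add0r.
have e2 : 0 < eps / 2 by rewrite divr_gt0.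
have H1 := second_increment v fu du e2.
have H2 := second_increment u fv dv e2.
have [d /= d0 Hd] := (nbhs_normP _ _).1 (filterI H1 H2).
(* A single nonzero [s] inside the common ball is enough; half the radius serves. *)
have [|h1 h2] := Hd (d / 2).
  by rewrite /ball_ /= sub0r normrN ger0_norm; lra.
have s0 : 0 < (d / 2) ^+ 2 by rewrite exprn_gt0 // divr_gt0.
rewrite -(ler_pM2r s0).
have tri (a S A B e : R) : `|a - S * A| <= e / 2 * S ->
  `|a - S * B| <= e / 2 * S ->
    0 < S -> `|A - B| * S <= e * S.
  move=> p q S0; have -> : `|A - B| * S = `|(a - S * B) - (a - S * A)|.
    by rewrite -[in LHS](gtr0_norm S0) -normrM; congr `|_|; ring.
  apply: (le_trans (ler_normB _ _)).
  by apply: (le_trans (lerD q p)); rewrite -mulrDl -splitr.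
apply: tri h1 _ s0.
have E1 : (d / 2) *: v + ((d / 2) *: u + x) = (d / 2) *: u + ((d / 2) *: v + x).
  by rewrite addrCA.
move: h2; rewrite E1.
rewrite [X in `|X - _| <= _](_ : _ = f ((d / 2) *: u + ((d / 2) *: v + x))
  - f ((d / 2) *: u + x) - (f ((d / 2) *: v + x) - f x)) //.
by ring.
Qed.

End Schwarz.

(** * Closure properties of C^k maps *)

Section CkBasic.
Context {R : realType} {E F : normedModType R}.
Implicit Types (U V : set E) (f g : E -> F) (k : nat).

Lemma Ck_continuous k U f x : Ck k U f -> U x -> {for x, continuous f}.
Proof. by case: k => [|k] [+ _]; apply. Qed.

Lemma Ck_derivable k U f x v : Ck k.+1 U f -> U x -> derivable f x v.
Proof. by move=> [_ /(_ v)[+ _]]; apply. Qed.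

Lemma Ck_derive k U f v : Ck k.+1 U f -> Ck k U ('D_v f).
Proof. by move=> [_ /(_ v)[]]. Qed.

Lemma CkW k U f : Ck k.+1 U f -> Ck k U f.
Proof.
elim: k f => [|k IH] f [fc fd]; first by split.
by split=> // v; have [dv /IH] := fd v.
Qed.

Lemma Ck_subset k U V f : V `<=` U -> Ck k U f -> Ck k V f.
Proof.
move=> VU; elim: k f => [|k IH] f [fc fd].
  by split=> // x /VU /fc.
split=> [x /VU /fc //|v]; have [dv /IH ?] := fd v.
by split=> // x /VU /dv.
Qed.

Lemma near_open U x (P : E -> Prop) : open U -> U x ->
  (forall y, U y -> P y) -> \forall y \near x, P y.
Proof. by move=> oU Ux UP; apply: filterS (open_nbhs_nbhs (conj oU Ux)). Qed.

Lemma Ck_ext k U f g : open U -> (forall x, U x -> f x = g x) ->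
  Ck k U f -> Ck k U g.
Proof.
move=> oU; elim: k f g => [|k IH] f g fg [fc fd].
  split=> // x Ux; apply: continuous_near_eq (fc _ Ux); exact: near_open fg.
split=> [x Ux|v].
  apply: continuous_near_eq (fc _ Ux); exact: near_open fg.
have [dv dk] := fd v; split=> [x Ux|].
  apply: near_eq_derivable (dv _ Ux); exact: near_open fg.
apply: IH dk => x Ux; apply: near_eq_derive; exact: near_open fg.
Qed.

Lemma Ck_differentiable {fE : finite_dim E} {fF : finite_dim F} k U f x :
  open U -> Ck k.+1 U f -> U x -> differentiable f x.
Proof.
move=> oU fk Ux; apply: C1_differentiable => v.
  by apply: (near_open oU Ux) => y; exact: Ck_derivable fk.
by apply: Ck_continuous Ux; exact: Ck_derive fk.
Qed.

Lemma Ck_cst k U (c : F) : Ck k U (fun=> c).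
Proof.
elim: k c => [|k IH] c; first by split=> // x _; exact: cvg_cst.
split=> [x _|v]; first exact: cvg_cst.
split=> [x _|]; first exact: derivable_cst.
have -> : 'D_v (fun=> c) = (fun=> 0) :> (E -> F).
  by apply/funext => x; exact: derive_cst.
exact: IH.
Qed.

Lemma CkD k U f g : open U -> Ck k U f -> Ck k U g ->
  Ck k U (fun x => f x + g x).
Proof.
move=> oU; elim: k f g => [|k IH] f g fk gk.
  split=> // x Ux; apply: cvgD; [exact: Ck_continuous fk Ux|exact: Ck_continuous
    gk Ux].
split=> [x Ux|v].
  apply: cvgD; [exact: Ck_continuous fk Ux|exact: Ck_continuous gk Ux].
split=> [x Ux|].
  apply: derivableD; [exact: Ck_derivable fk Ux|exact: Ck_derivable gk Ux].
apply: (Ck_ext (f := fun x => 'D_v f x + 'D_v g x)) => // [x Ux|].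
  by rewrite -deriveD //; [exact: Ck_derivable fk Ux|exact: Ck_derivable gk Ux].
by apply: IH; exact: Ck_derive.
Qed.

Lemma Ck_sum k U m (f : 'I_m -> E -> F) : open U -> (forall i, Ck k U (f i)) ->
  Ck k U (fun x => \sum_i f i x).
Proof.
move=> oU fk.
have -> : (fun x => \sum_i f i x) = \sum_i f i by apply/funext => x;
  rewrite fct_sumE.
elim/big_ind : _ => // [|g h]; first exact: Ck_cst.
exact: CkD.
Qed.

(** In the difference quotient [g] is taken at the shifted point. Its continuity is a separate
    assumption because derivability in one direction does not imply it. *)
Lemma is_derive_scale (f : E -> R) g x v :
  {for x, continuous g} -> derivable f x v -> derivable g x v ->
  is_derive x v (fun y => f y *: g y) ('D_v f x *: g x + f x *: 'D_v g x).
Proof.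
move=> gc fd gd.
have H : h^-1 *: (((fun y => f y *: g y) \o shift x) (h *: v) - f x *: g x)
    @[h --> (0:R)^'] --> 'D_v f x *: g x + f x *: 'D_v g x.
  rewrite [X in X @ _](_ : _ = (fun h : R =>
     (h^-1 *: ((f \o shift x) (h *: v) - f x)) *: g (h *: v + x) +
      f x *: (h^-1 *: ((g \o shift x) (h *: v) - g x)))); last first.
    apply/funext => h /=.
    rewrite [(_ *: (_ : R)) *: _](_ : _ =
       h^-1 *: ((f (h *: v + x) - f x) *: g (h *: v + x)));
         last by rewrite scalerA.
    rewrite [f x *: (_ *: _)]scalerA [f x * _]mulrC -scalerA -scalerDr;
      congr (_ *: _).
    by rewrite scalerBl scalerBr addrA subrK.
  apply: cvgD; last by apply: cvgZl_tmp; exact: gd.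
  apply: cvgZ; first exact: fd.
  suff : (fun h : R => h *: v + x) @ (0:R)^' --> x by move/cvg_comp; apply.
  apply: cvg_trans (_ : (fun h : R => h *: v + x) @ (0 : R) --> x).
    exact/cvg_app/cvg_within.
  rewrite -[X in _ --> X]add0r -[X in _ --> X + _](scale0r v).
  by apply: cvgD; [apply: cvgZr_tmp; exact: cvg_id|exact: cvg_cst].
by split; [apply/cvg_ex; eexists; exact: H|exact: cvg_lim H].
Qed.

End CkBasic.

Section CkOperations.
Context {R : realType} {E F : normedModType R}.
Implicit Types (U V : set E) (k : nat).

Lemma CkZ k U (f : E -> R) (g : E -> F) : open U -> Ck k U f -> Ck k U g ->
  Ck k U (fun x => f x *: g x).
Proof.
move=> oU; elim: k f g => [|k IH] f g fk gk.
  split=> // x Ux; apply: cvgZ; [exact: Ck_continuous fk Ux|exact: Ck_continuous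
    gk Ux].
have d x v : U x -> is_derive x v (fun y => f y *: g y) ('D_v f x *: g x + f x
  *: 'D_v g x).
  move=> Ux; apply: is_derive_scale; first exact: Ck_continuous gk Ux.
    exact: Ck_derivable fk Ux.
  exact: Ck_derivable gk Ux.
split=> [x Ux|v].
  apply: cvgZ; [exact: Ck_continuous fk Ux|exact: Ck_continuous gk Ux].
split=> [x /(d x v) []//|].
apply: (Ck_ext (f := fun x => 'D_v f x *: g x + f x *: 'D_v g x)) => // [x Ux|].
  by have [_ ->] := d x v Ux.
apply: CkD => //; apply: IH; try exact: Ck_derive; exact: CkW.
Qed.

Lemma Ck_linear_comp (G : normedModType R) k U (a : {linear F -> G}) (f : E ->
  F) :
  open U -> continuous a -> Ck k U f -> Ck k U (a \o f).
Proof.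
move=> oU ac; elim: k f => [|k IH] f fk.
  split=> // x Ux; apply: continuous_comp; [exact: Ck_continuous fk Ux|exact:
    ac].
split=> [x Ux|v].
  apply: continuous_comp; [exact: Ck_continuous fk Ux|exact: ac].
have d x : U x -> is_derive x v (a \o f) (a ('D_v f x)).
  by move=> Ux; apply: derive_linear_comp => //; exact: Ck_derivable fk Ux.
split=> [x /d[]//|].
apply: (Ck_ext (f := a \o 'D_v f)) => // [x /d[_ ->]//|].
by apply: IH; exact: Ck_derive.
Qed.

Lemma Ck_linear k U (a : {linear E -> F}) : continuous a -> Ck k U a.
Proof.
move=> ac; case: k => [|k]; first by split=> // x _; exact: ac.
have d x v : is_derive x v a (a v).
  have := derive_linear_comp (f := id) ac (@derivable_id _ _ x v).
  by rewrite derive_id.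
split=> [x _|v]; first exact: ac.
split=> [x _|]; first by have [] := d x v.
have -> : 'D_v a = (fun=> a v) by apply/funext => x; have [] := d x v.
exact: Ck_cst.
Qed.

End CkOperations.

Section CkAlong.
Context {R : realType} {E F : normedModType R}.
Context {fE : finite_dim E} {fF : finite_dim F}.

Lemma derive_dir_sum (f : E -> F) x m (a : 'I_m -> R) (e : 'I_m -> E) :
  differentiable f x -> 'D_(\sum_i a i *: e i) f x = \sum_i a i *: 'D_(e i) f x.
Proof.
move=> fd; rewrite (deriveE _ fd) linear_sum; apply: eq_bigr => i _.
by rewrite linearZ (deriveE _ fd).
Qed.

(** Expanding the varying direction in the [e i] leaves derivatives in fixed directions, the only
    ones [Ck] knows, with C^k coefficients. *)
Lemma Ck_derive_along k (U : set E) (f : E -> F) (v : E -> E) : open U ->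
  Ck k.+1 U f -> Ck k U v -> Ck k U (fun x => 'D_(v x) f x).
Proof.
move=> oU fk vk; have [m [e [a [ac aE]]]] := fE.
apply: (Ck_ext (f := fun x => \sum_i a i (v x) *: 'D_(e i) f x)) => // [x Ux|].
  rewrite [in RHS](aE (v x)) derive_dir_sum //;
    exact: (Ck_differentiable oU fk).
apply: Ck_sum => // i; apply: CkZ => //; last exact: Ck_derive.
exact: Ck_linear_comp.
Qed.

End CkAlong.

Section CkComposition.
Context {R : realType} {E F G : normedModType R}.
Context {fE : finite_dim E} {fF : finite_dim F} {fG : finite_dim G}.

(** By the chain rule ['D_v (g \o f)] is a sum of products of [a i ('D_v f)] with ['D_(e i) g \o f].
    The latter is again a composite, of maps that are one order lower, which closes the
    induction. *)
Lemma Ck_comp k (U : set E) (V : set F) (f : E -> F) (g : F -> G) :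
  open U -> open V -> (forall x, U x -> V (f x)) ->
  Ck k U f -> Ck k V g -> Ck k U (g \o f).
Proof.
move=> oU oV UV; elim: k f g UV => [|k IH] f g UV fk gk.
  split=> // x Ux; apply: continuous_comp; [exact: Ck_continuous fk Ux|].
  by apply: (Ck_continuous gk); exact: UV.
have df x : U x -> differentiable f x by exact: (Ck_differentiable oU fk).
have dg x : U x -> differentiable g (f x).
  by move=> /UV; exact: (Ck_differentiable oV gk).
split=> [x Ux|v].
  apply: continuous_comp; [exact: Ck_continuous fk Ux|].
  by apply: (Ck_continuous gk); exact: UV.
split=> [x Ux|].
  by apply: diff_derivable; apply: differentiable_comp; [exact: df|exact: dg].
have [m [e [a [ac aE]]]] := fF.
apply: (Ck_ext (f := fun x => \sum_i a i ('D_v f x) *: ('D_(e i) g \o f) x)) =>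
  //.
  move=> x Ux; rewrite (derive_comp v (df x Ux) (dg x Ux)).
  by rewrite [in RHS](aE ('D_v f x)) derive_dir_sum //; exact: dg.
apply: Ck_sum => // i; apply: CkZ => //.
  by apply: Ck_linear_comp => //; exact: Ck_derive.
by apply: IH => //; [exact: CkW|exact: Ck_derive].
Qed.

End CkComposition.

(* Conversion checks between two iterated derivatives are intractable once
   [derive] is unfolded. *)
#[local] Opaque derive.

Section VectorSchwarz.
Context {R : realType} {E F : normedModType R}.
Context {fE : finite_dim E} {fF : finite_dim F}.

Lemma schwarz (U : set E) (f : E -> F) x u v : open U -> U x -> Ck 2 U f ->
  'D_v ('D_u f) x = 'D_u ('D_v f) x.
Proof.
move=> oU Ux fk; have [m [e [a [ac aE]]]] := fF.
apply: etrans (aE _) (etrans _ (esym (aE _))).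
apply: eq_bigr => i _; apply: (congr1 ( *:%R^~ (e i))).
have ak : Ck 2 U (a i \o f) by exact: Ck_linear_comp.
have d1 y w : U y -> 'D_w (a i \o f) y = a i ('D_w f y).
  move=> Uy; have [//|_ ->//] := derive_linear_comp (f := f) (x := y) (v :=
    w) (ac i).
  exact: Ck_derivable fk Uy.
have d2 y w w' : U y -> 'D_w' ('D_w (a i \o f)) y = a i ('D_w' ('D_w f) y).
  move=> Uy; rewrite (near_eq_derive (g := a i \o 'D_w f));
    last exact: near_open (d1 ^~ w).
  have [//|_ ->//] := derive_linear_comp (f := 'D_w f) (x := y) (v :=
    w') (ac i).
  exact: Ck_derivable (Ck_derive w fk) Uy.
apply: etrans (esym (d2 _ _ _ Ux)) (etrans _ (d2 _ _ _ Ux)).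
apply: schwarz_scalar.
- by apply: (near_open oU Ux) => y; exact: Ck_derivable ak.
- by apply: (near_open oU Ux) => y; exact: Ck_derivable ak.
- exact: (Ck_differentiable oU (Ck_derive u ak)).
- exact: (Ck_differentiable oU (Ck_derive v ak)).
Qed.

End VectorSchwarz.

(** * Tangent vectors and vector fields in charts *)

Section Charts.
Context {R : realType} {E : normedModType R} {fE : finite_dim E}.
Context {M : manifold E}.
Implicit Types (c : chart M) (p : M) (U : set M) (v : E).

Lemma ch_image_inv c U x : (ch_map c @` (ch_dom c `&` U)) x ->
  [/\ ch_dom c (ch_inv c x), U (ch_inv c x) & ch_map c (ch_inv c x) = x].
Proof. by move=> [p [cp Up] <-]; rewrite ch_mapK. Qed.

Lemma ch_image_mem c U p : ch_dom c p -> U p ->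
  (ch_map c @` (ch_dom c `&` U)) (ch_map c p).
Proof. by move=> cp Up; exists p. Qed.

(** The atlas provides open images for whole chart domains only; continuity of [ch_inv] handles the
    smaller set. *)
Lemma ch_image_open c U : open U -> open (ch_map c @` (ch_dom c `&` U)).
Proof.
move=> oU; rewrite openE => _ [p [cp Up] <-]; rewrite /interior.
have cpi : (ch_map c @` ch_dom c) (ch_map c p) by exists p.
have ic : \forall y \near ch_map c p, U (ch_inv c y).
  apply: (ch_inv_continuous cpi); rewrite ch_mapK //.
  exact: open_nbhs_nbhs.
have dc : \forall y \near ch_map c p, (ch_map c @` ch_dom c) y.
  by apply: open_nbhs_nbhs; split => //; exact: ch_img_open.
by apply: filterS2 ic dc => y Uy [q cq qy]; exists q => //; split=> //;
  move: Uy; rewrite -qy ch_mapK.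
Qed.

Lemma near_ch_image c U p : open U -> ch_dom c p -> U p ->
  \forall y \near ch_map c p, (ch_map c @` (ch_dom c `&` U)) y.
Proof.
move=> oU cp Up; apply: open_nbhs_nbhs; split; first exact: ch_image_open.
by exists p.
Qed.

Lemma dfunE {F : normedModType R} (f : M -> F) p v :
  dfun f p v = 'D_v (f \o ch_inv (chart_at p)) (ch_map (chart_at p) p).
Proof. exact: (derive1_at0 (f \o ch_inv (chart_at p))). Qed.

Lemma chart_at_open p : open_nbhs p (ch_dom (chart_at p)).
Proof. by split; [exact: ch_dom_open|exact: chart_atP]. Qed.

Lemma transition_differentiable c c' p : ch_dom c p -> ch_dom c' p ->
  differentiable (ch_map c' \o ch_inv c) (ch_map c p).
Proof.
move=> cp c'p; apply: (Ck_differentiable _ (@ch_transition _ _ M c c' 1)).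
  exact/ch_image_open/ch_dom_open.
exact: ch_image_mem.
Qed.

Lemma through_chart {T : Type} (f : M -> T) c c' p : ch_dom c p ->
  ch_dom c' p ->
  \forall x \near ch_map c p,
    (f \o ch_inv c) x = ((f \o ch_inv c') \o (ch_map c' \o ch_inv c)) x.
Proof.
move=> cp c'p; apply: filterS (near_ch_image (ch_dom_open c') cp c'p) => x.
by move=> /ch_image_inv[_ /= ic' _]; rewrite (ch_mapK ic').
Qed.

Lemma derive_through_chart {F : normedModType R} (f : M -> F) c c' p v :
  ch_dom c p -> ch_dom c' p ->
  differentiable (f \o ch_inv c') (ch_map c' p) ->
  'D_v (f \o ch_inv c) (ch_map c p) =
  'D_('D_v (ch_map c' \o ch_inv c) (ch_map c p)) (f \o ch_inv c') (ch_map c' p).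
Proof.
move=> cp c'p fd; have td := transition_differentiable cp c'p.
rewrite (near_eq_derive _ (through_chart f cp c'p)) derive_comp //=.
  by rewrite ch_mapK.
by rewrite ch_mapK.
Qed.

(** [dfun] is tied to [chart_at p]. Differentiability of the local expression makes it computable in
    whichever chart is at hand. *)
Lemma dfun_chart {F : normedModType R} (f : M -> F) c p v : ch_dom c p ->
  differentiable (f \o ch_inv c) (ch_map c p) ->
  dfun f p v = 'D_(comp c p v) (f \o ch_inv c) (ch_map c p).
Proof.
move=> cp fd; rewrite /comp !dfunE.
by apply: derive_through_chart => //; exact: chart_atP.
Qed.

Lemma frameE c v p : ch_dom c p ->
  frame c v p = 'D_v (ch_map (chart_at p) \o ch_inv c) (ch_map c p).
Proof.
move=> cp; rewrite /frame /velocity scale0r addr0 ch_mapK //.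
exact: (derive1_at0 (ch_map (chart_at p) \o ch_inv c)).
Qed.

Lemma comp_frame c c' p v : ch_dom c p -> ch_dom c' p ->
  comp c' p (frame c v p) = 'D_v (ch_map c' \o ch_inv c) (ch_map c p).
Proof.
move=> cp c'p; rewrite frameE // /comp dfunE; apply/esym.
apply: derive_through_chart => //; first exact: chart_atP.
exact: transition_differentiable (chart_atP p) c'p.
Qed.

Lemma derive_ch_id c p v : ch_dom c p ->
  'D_v (ch_map c \o ch_inv c) (ch_map c p) = v.
Proof.
move=> cp; rewrite (near_eq_derive (g := id)) ?derive_id //.
by apply: filterS (near_ch_image openT cp Logic.I) => x /ch_image_inv[].
Qed.

(** Here and in [compK]: the derivatives of the transition maps between [c] and [chart_at p] are
    inverse to each other. *)
Lemma frameK c p v : ch_dom c p -> comp c p (frame c v p) = v.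
Proof. by move=> cp; rewrite comp_frame // derive_ch_id. Qed.

Lemma compK c p v : ch_dom c p -> frame c (comp c p v) p = v.
Proof.
move=> cp; rewrite frameE // /comp dfunE -derive_through_chart //.
- by apply: derive_ch_id; exact: chart_atP.
- exact: chart_atP.
- exact: transition_differentiable cp (chart_atP p).
Qed.

Lemma comp_chart_at p v : comp (chart_at p) p v = v.
Proof. by rewrite /comp dfunE derive_ch_id //; exact: chart_atP. Qed.

Lemma frame_chart_at p v : frame (chart_at p) v p = v.
Proof. by rewrite frameE ?derive_ch_id //; exact: chart_atP. Qed.

Lemma comp_linear c p : ch_dom c p -> linear (comp c p).
Proof.
move=> cp k u v; rewrite /comp !dfunE; apply: derive_dir_linear.
exact: transition_differentiable (chart_atP p) cp.
Qed.

Lemma frame_linear c p : ch_dom c p -> linear (frame c ^~ p).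
Proof.
move=> cp k u v; rewrite !frameE //; apply: derive_dir_linear.
exact: transition_differentiable cp (chart_atP p).
Qed.

Lemma comp_change c c' p v : ch_dom c p -> ch_dom c' p ->
  comp c' p v = 'D_(comp c p v) (ch_map c' \o ch_inv c) (ch_map c p).
Proof.
move=> cp c'p; rewrite {1}/comp; apply: dfun_chart => //.
exact: transition_differentiable.
Qed.

Lemma smooth_on_change {F : normedModType R} {fF : finite_dim F} (c c' :
  chart M) U (f : M -> F) :
  open U -> U `<=` ch_dom c ->
  smooth_on (ch_map c @` (ch_dom c `&` U)) (f \o ch_inv c) ->
  smooth_on (ch_map c' @` (ch_dom c' `&` U)) (f \o ch_inv c').
Proof.
move=> oU Uc fs k; have oc' := ch_image_open c' oU;
  have oc := ch_image_open c oU.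
apply: (Ck_ext (f := (f \o ch_inv c) \o (ch_map c \o ch_inv c'))) => //.
  by move=> x /ch_image_inv[_ /Uc xc _] /=; rewrite (ch_mapK xc).
apply: (Ck_comp (V := ch_map c @` (ch_dom c `&` U))) => //.
  by move=> x /ch_image_inv[_ xU _] /=; apply: ch_image_mem => //; exact: Uc.
apply: Ck_subset (@ch_transition _ _ M c' c k).
by move=> x [p [c'p Up] <-]; exists p => //; split=> //; exact: Uc.
Qed.

Lemma smooth_fun_chart c U (f : M -> R) : open U -> U `<=` ch_dom c ->
  smooth_on (ch_map c @` (ch_dom c `&` U)) (f \o ch_inv c) -> smooth_fun_on U f.
Proof. by move=> oU Uc fs c'; exact: (smooth_on_change _ oU Uc). Qed.

(** Components change by the derivative of the transition map in the direction of the field. This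
    costs one order of the transition map, which is smooth to all orders. *)
Lemma smooth_vf_chart c U (Z : M -> E) : open U -> U `<=` ch_dom c ->
  smooth_on (ch_map c @` (ch_dom c `&` U))
    (fun x => comp c (ch_inv c x) (Z (ch_inv c x))) -> smooth_vf_on U Z.
Proof.
move=> oU Uc Zs c'; set g := fun x => _.
have -> : g = (fun p => comp c' p (Z p)) \o ch_inv c' by [].
pose V := U `&` ch_dom c'.
have oV : open V by apply: openI => //; exact: ch_dom_open.
have VE : ch_map c' @` (ch_dom c' `&` U) = ch_map c' @` (ch_dom c' `&` V).
  by congr (_ @` _); by apply/seteqP; split=> p [c'p] => [Up|[Up _]].
have Vc : V `<=` ch_dom c by move=> p [/Uc].
rewrite VE; apply: (smooth_on_change c' oV Vc) => k.
have oc := ch_image_open c oV.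
apply: (Ck_ext (f := fun x => 'D_(comp c (ch_inv c x) (Z (ch_inv c x)))
   (ch_map c' \o ch_inv c) x)) => //.
  move=> x /ch_image_inv[cx [Ux c'x] xE].
  by rewrite /= [RHS](comp_change _ cx c'x) xE.
apply: Ck_derive_along => //.
  apply: Ck_subset (@ch_transition _ _ M c c' k.+1).
  by move=> x [p [cp [Up c'p]] <-]; exists p.
by apply: Ck_subset (Zs k) => x [p [cp [Up c'p]] <-]; exists p.
Qed.

Lemma smooth_vf_frame c v : smooth_vf_on (ch_dom c) (frame c v).
Proof.
apply: (smooth_vf_chart (ch_dom_open c) (@subset_refl _ _)) => k.
apply: (@Ck_ext _ _ _ k _ (fun=> v)); first exact/ch_image_open/ch_dom_open.
  by move=> x /ch_image_inv[cx _ _]; rewrite frameK.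
exact: Ck_cst.
Qed.

End Charts.

(** * Consequences of linearity for functions that are not bundled as linear maps *)

Section UnbundledLinear.
Context {R : pzRingType} {V W : lmodType R} {L : V -> W}.
Hypothesis Llin : linear L.
Let LM := GRing.isLinear.Build _ _ _ _ _ Llin.
Let LL : {linear V -> W} := HB.pack L LM.

Lemma linear_fun0 : L 0 = 0. Proof. exact: (linear0 LL). Qed.

Lemma linear_funN u : L (- u) = - L u. Proof. exact: (linearN LL). Qed.

Lemma linear_funD u v : L (u + v) = L u + L v. Proof. exact: (linearD LL). Qed.

Lemma linear_funZ k u : L (k *: u) = k *: L u. Proof. exact: (linearZ_LR LL).
  Qed.

Lemma linear_fun_sum m (a : 'I_m -> R) (e : 'I_m -> V) :
  L (\sum_i a i *: e i) = \sum_i a i *: L (e i).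
Proof.
apply: etrans (linear_sum LL _ _ _) _; apply: eq_bigr => i _;
  exact: linear_funZ.
Qed.

End UnbundledLinear.

Section LocalFields.
Context {R : realType} {E : normedModType R} {fE : finite_dim E}.
Context {M : manifold E}.
Implicit Types (c : chart M) (p : M) (U V : set M) (v : E).

Lemma near_ch_inv c p (P : set M) : ch_dom c p -> (\forall q \near p, P q) ->
  \forall x \near ch_map c p, P (ch_inv c x).
Proof.
move=> cp Pp; have cpi : (ch_map c @` ch_dom c) (ch_map c p) by exists p.
by apply: (ch_inv_continuous cpi); rewrite ch_mapK.
Qed.

Lemma dfun_near_eq {F : normedModType R} (f g : M -> F) p v :
  (\near p, f p = g p) -> dfun f p v = dfun g p v.
Proof.
move=> fg; rewrite !dfunE; apply: near_eq_derive.
exact: near_ch_inv (chart_atP p) fg.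
Qed.

Lemma dfun_cst {F : normedModType R} (k : F) p v : dfun (fun=> k) p v = 0.
Proof. by rewrite dfunE; exact: derive_cst. Qed.

Lemma smooth_vf_subset U V (Z : M -> E) : V `<=` U ->
  smooth_vf_on U Z -> smooth_vf_on V Z.
Proof.
move=> VU Zs c k; apply: Ck_subset (Zs c k) => x [p [cp Vp] <-].
by exists p => //; split=> //; exact: VU.
Qed.

Lemma smooth_vf_add U (Z Z' : M -> E) : open U ->
  smooth_vf_on U Z -> smooth_vf_on U Z' -> smooth_vf_on U (fun p => Z p + Z' p).
Proof.
move=> oU Zs Z's c k; have oc := ch_image_open c oU.
apply: (Ck_ext oc _ (CkD oc (Zs c k) (Z's c k))).
move=> x /ch_image_inv[cx _ _].
by rewrite (linear_funD (comp_linear cx)).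
Qed.

Lemma smooth_vf_scale U (f : M -> R) (Z : M -> E) : open U ->
  smooth_fun_on U f -> smooth_vf_on U Z -> smooth_vf_on U (fun p => f p *: Z p).
Proof.
move=> oU fs Zs c k; have oc := ch_image_open c oU.
apply: (Ck_ext oc _ (CkZ oc (fs c k) (Zs c k))) => x /ch_image_inv[cx _ _].
by rewrite (linear_funZ (comp_linear cx)).
Qed.

Lemma smooth_fun_cst U k : smooth_fun_on U (fun=> k).
Proof. by move=> c m; exact: Ck_cst. Qed.

Lemma smooth_vf_at_near_eq p (Z Z' : M -> E) :
  (\near p, Z p = Z' p) -> smooth_vf_at p Z -> smooth_vf_at p Z'.
Proof.
move=> ZZ'; have : nbhs p [set q | Z q = Z' q] by exact: ZZ'.
rewrite nbhsE => -[V [oV Vp] VZ] [U [oU Up] Zs].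
have oW := openI oU oV.
exists (U `&` V) => // c k.
have oc := ch_image_open c oW.
apply: (Ck_ext oc _ (smooth_vf_subset (@subIsetl _ U V) Zs c k)).
by move=> x /ch_image_inv[cx [_ /VZ Vx] _]; rewrite Vx.
Qed.

Lemma smooth_vf_at_coord p (Z : M -> E) c : ch_dom c p -> smooth_vf_at p Z ->
  differentiable ((fun q => comp c q (Z q)) \o ch_inv c) (ch_map c p).
Proof.
move=> cp [U [oU Up] Zs]; have oc := ch_image_open c oU.
exact: (Ck_differentiable oc (Zs c 1) (ch_image_mem cp Up)).
Qed.

Lemma dfunD {F : normedModType R} (f g : M -> F) c p v : ch_dom c p ->
  differentiable (f \o ch_inv c) (ch_map c p) ->
  differentiable (g \o ch_inv c) (ch_map c p) ->
  dfun (fun q => f q + g q) p v = dfun f p v + dfun g p v.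
Proof.
move=> cp df dg; rewrite (dfun_chart v cp df) (dfun_chart v cp dg).
rewrite (dfun_chart v cp (differentiableD df dg)).
by apply: deriveD; exact: diff_derivable.
Qed.

Lemma dfun_linear {F : normedModType R} (f : M -> F) c p : ch_dom c p ->
  differentiable (f \o ch_inv c) (ch_map c p) -> linear (dfun f p).
Proof.
move=> cp df k u v; rewrite !(dfun_chart _ cp df) comp_linear //.
exact: derive_dir_linear.
Qed.

Lemma smooth_fun_differentiable c U (f : M -> R) p : open U -> U p ->
  ch_dom c p ->
  smooth_fun_on U f -> differentiable (f \o ch_inv c) (ch_map c p).
Proof.
move=> oU Up cp fs; have oc := ch_image_open c oU.
exact: (Ck_differentiable oc (fs c 1) (ch_image_mem cp Up)).
Qed.

End LocalFields.

(** * Connections in coordinates *)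

Section ConnectionCoordinates.
Context {R : realType} {E : normedModType R} {fE : finite_dim E}.
Context {M : manifold E} {nabla : M -> E -> (M -> E) -> E}.
Hypothesis nablaP : is_connection nabla.
Implicit Types (c : chart M) (p : M) (U V : set M) (u v : E) (Z : M -> E).

Lemma nabla_add p v Z Z' : smooth_vf_at p Z -> smooth_vf_at p Z' ->
  nabla p v (fun q => Z q + Z' q) = nabla p v Z + nabla p v Z'.
Proof. by case: nablaP => _ + _ _; exact. Qed.

Lemma nabla_leibniz p v (f : M -> R) Z : smooth_fun_at p f ->
  smooth_vf_at p Z ->
  nabla p v (fun q => f q *: Z q) = dfun f p v *: Z p + f p *: nabla p v Z.
Proof. by case: nablaP => _ _ + _; exact. Qed.

Lemma nabla_linear p Z : smooth_vf_at p Z -> linear (fun v => nabla p v Z).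
Proof. by case: nablaP => + _ _ _; exact. Qed.

Lemma smooth_fun_at_cst p k : smooth_fun_at p (fun=> k).
Proof. by exists setT; [split; [exact: openT|]|exact: smooth_fun_cst]. Qed.

Lemma smooth_vf_at_frame c p u : ch_dom c p -> smooth_vf_at p (frame c u).
Proof.
by move=> cp; exists (ch_dom c); [split; [exact: ch_dom_open|]|exact:
  smooth_vf_frame].
Qed.

Lemma nablaZ p v k Z : smooth_vf_at p Z ->
  nabla p v (fun q => k *: Z q) = k *: nabla p v Z.
Proof.
move=> Zs; rewrite (nabla_leibniz v (smooth_fun_at_cst p k) Zs) dfun_cst.
by rewrite scale0r add0r.
Qed.

(* The Leibniz rule for the indicator function of a neighbourhood of p. *)
Lemma nabla_near_eq p v Z Z' : smooth_vf_at p Z -> (\near p, Z p = Z' p) ->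
  nabla p v Z = nabla p v Z'.
Proof.
move=> Zs ZZ'; have Z's := smooth_vf_at_near_eq ZZ' Zs.
have : nbhs p [set q | Z q = Z' q] by exact: ZZ'.
rewrite nbhsE => -[V [oV Vp] VZ].
pose f q : R := if `[< V q >] then 1 else 0.
have fV q : V q -> f q = 1 by move=> Vq; rewrite /f asboolT.
have fs : smooth_fun_at p f.
  exists V => // c k; have oc := ch_image_open c oV.
  apply: (Ck_ext oc _ (Ck_cst k _ (1 : R))) => x /ch_image_inv[_ Vx _].
  by rewrite /= fV.
have df : dfun f p v = 0.
  rewrite -(dfun_cst (1 : R) p v); apply: dfun_near_eq.
  by apply: filterS (open_nbhs_nbhs (conj oV Vp)) => q /fV.
have H Z0 : smooth_vf_at p Z0 -> nabla p v (fun q =>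
  f q *: Z0 q) = nabla p v Z0.
  by move=> Z0s; rewrite nabla_leibniz // df scale0r add0r fV // scale1r.
rewrite -H // -[RHS]H //; congr (nabla p v _); apply/funext => q.
by rewrite /f; case: asboolP => [/VZ /= -> //|_]; rewrite !scale0r.
Qed.

Lemma smooth_vf_at_scale p (f : M -> R) Z : smooth_fun_at p f ->
  smooth_vf_at p Z -> smooth_vf_at p (fun q => f q *: Z q).
Proof.
move=> [U [oU Up] fU] [V [oV Vp] ZV]; have oW := openI oU oV.
exists (U `&` V) => //; apply: smooth_vf_scale => //.
  move=> c k; apply: Ck_subset (fU c k) => x [q [cq [Uq _]] <-].
  by exists q.
exact: smooth_vf_subset (@subIsetr _ U V) ZV.
Qed.

Lemma smooth_vf_at_add p Z Z' : smooth_vf_at p Z -> smooth_vf_at p Z' ->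
  smooth_vf_at p (fun q => Z q + Z' q).
Proof.
move=> [U [oU Up] ZU] [V [oV Vp] Z'V]; have oW := openI oU oV.
exists (U `&` V) => //; apply: smooth_vf_add => //.
  exact: smooth_vf_subset (@subIsetl _ U V) ZU.
exact: smooth_vf_subset (@subIsetr _ U V) Z'V.
Qed.

Lemma smooth_vf_at_sum p m (Z : 'I_m -> M -> E) : (forall i,
  smooth_vf_at p (Z i)) ->
  forall r : seq 'I_m, smooth_vf_at p (fun q => \sum_(i <- r) Z i q).
Proof.
move=> Zs; elim=> [|i r [U [oU Up] IH]].
  exists setT; first by split; [exact: openT|].
  move=> c k; have oc := ch_image_open c (@openT M).
  apply: (Ck_ext oc _ (Ck_cst k _ 0)) => x /ch_image_inv[cx _ _].
  by rewrite big_nil (linear_fun0 (comp_linear cx)).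
have -> : (fun q => \sum_(k <- i :: r) Z k q) = fun q =>
  Z i q + \sum_(k <- r) Z k q.
  by apply/funext => q; rewrite big_cons.
by apply: smooth_vf_at_add => //; exists U.
Qed.

Lemma nabla_sum p v m (Z : 'I_m -> M -> E) : (forall i, smooth_vf_at p (Z i)) ->
  nabla p v (fun q => \sum_i Z i q) = \sum_i nabla p v (Z i).
Proof.
move=> Zs; elim: (index_enum _) => [|i r IH].
  rewrite big_nil.
  (* The connection axioms have no clause for the zero field, so it is written as 0 times a
     coordinate field. *)
  have -> : (fun q => \sum_(k <- [::]) Z k q) = fun q =>
    0 *: frame (chart_at p) 0 q.
    by apply/funext => q; rewrite big_nil scale0r.
  by rewrite nablaZ ?scale0r //; apply: smooth_vf_at_frame; exact: chart_atP.
have -> : (fun q => \sum_(k <- i :: r) Z k q) = fun q =>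
  Z i q + \sum_(k <- r) Z k q.
  by apply/funext => q; rewrite big_cons.
rewrite big_cons -IH nabla_add //; exact: smooth_vf_at_sum.
Qed.

(** Near [p] the field is a combination of coordinate fields with smooth coefficients, and the
    Leibniz rule separates the derivatives of the coefficients from the Christoffel part. The latter
    depends on [Z p] only, hence is the same for the field with constant components [Z p]. *)
Lemma nabla_coord p v Z : smooth_vf_at p Z ->
  nabla p v Z = dfun (fun q => comp (chart_at p) q (Z q)) p v +
                nabla p v (frame (chart_at p) (Z p)).
Proof.
have [m [e [a [ac aE]]]] := fE; set c := chart_at p.
have cp : ch_dom c p := chart_atP p.
have es i : smooth_vf_at p (frame c (e i)) by exact: smooth_vf_at_frame.
have expand Z0 : smooth_vf_at p Z0 -> nabla p v Z0 =
    dfun (fun q => comp c q (Z0 q)) p v +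
    \sum_i a i (Z0 p) *: nabla p v (frame c (e i)).
  move=> Z0s; have Zd := smooth_vf_at_coord (fE := fE) cp Z0s.
  pose f i q := a i (comp c q (Z0 q)).
  have fs i : smooth_fun_at p (f i).
    have [U [oU Up] Us] := Z0s.
    have oV := openI oU (ch_dom_open c); exists (U `&` ch_dom c) => //.
    apply: (smooth_fun_chart (c := c)) => // k.
    have oc := ch_image_open c oV.
    have Zk := Ck_linear_comp oc (ac i)
      (smooth_vf_subset (@subIsetl _ U (ch_dom c)) Us c k).
    exact: (Ck_ext oc _ Zk).
  have -> : nabla p v Z0 = nabla p v (fun q => \sum_i f i q *: frame c (e i) q).
    apply: nabla_near_eq => //.
    apply: filterS (open_nbhs_nbhs (conj (ch_dom_open c) cp)) => q cq.
    rewrite -{1}(compK (Z0 q) cq) {1}(aE (comp c q (Z0 q))).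
    exact: (linear_fun_sum (frame_linear cq) _ _).
  rewrite nabla_sum => [|i]; last exact: smooth_vf_at_scale.
  have -> : dfun (fun q => comp c q (Z0 q)) p v = \sum_i dfun (f i) p v *: e i.
    rewrite (aE (dfun _ _ _)); apply: eq_bigr => i _;
      apply: (congr1 ( *:%R^~ (e i))).
    rewrite [RHS]dfunE dfunE.
    have [_ DE] := derive_linear_comp (ac i) (diff_derivable (v := v) Zd).
    exact: esym DE.
  rewrite -big_split; apply: eq_bigr => i _.
  by rewrite nabla_leibniz // frame_chart_at /f comp_chart_at.
move=> Zs; rewrite expand //; congr (_ + _).
(* The expansion of the field with constant components: its derivative term is zero, and the
   Christoffel sums match. *)
rewrite expand; last exact: smooth_vf_at_frame.
rewrite [X in X + _](_ : _ = 0) ?add0r; last first.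
  rewrite -(dfun_cst (Z p) p v); apply: dfun_near_eq.
  by apply: filterS (open_nbhs_nbhs (conj (ch_dom_open c) cp)) => q cq;
    rewrite frameK.
by apply: eq_bigr => i _; rewrite frame_chart_at.
Qed.

End ConnectionCoordinates.

Section Christoffel.
Context {R : realType} {E : normedModType R} {fE : finite_dim E}.
Context {M : manifold E} {nabla : M -> E -> (M -> E) -> E}.
Hypothesis nablaP : is_connection nabla.
Implicit Types (c : chart M) (p : M) (u v : E).

Lemma near_chart_dom c p (P : M -> Prop) : ch_dom c p ->
  (forall q, ch_dom c q -> P q) -> \forall q \near p, P q.
Proof.
move=> cp H; apply: filterS (open_nbhs_nbhs (conj (ch_dom_open c) cp)).
exact: H.
Qed.

(** [frame] is linear in [u] on the chart domain only, so locality of the connection is needed. *)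
Lemma christoffel_linear p v :
  linear (fun u => nabla p v (frame (chart_at p) u)).
Proof.
move=> k u u'; set c := chart_at p; have cp : ch_dom c p := chart_atP p.
have s w : smooth_vf_at p (frame c w) by exact: smooth_vf_at_frame.
have ks : smooth_vf_at p (fun q => k *: frame c u q).
  by apply: smooth_vf_at_scale => //; exact: smooth_fun_at_cst.
rewrite (nabla_near_eq nablaP v (Z' := fun q => k *: frame c u q + frame c u'
  q)) //.
  by rewrite (nabla_add nablaP) // (nablaZ nablaP).
by apply: (near_chart_dom cp) => q cq; exact: frame_linear.
Qed.

Lemma dfun_comp_frame p u v :
  dfun (fun q => comp (chart_at p) q (frame (chart_at p) u q)) p v = 0.
Proof.
rewrite -(dfun_cst u p v); apply: dfun_near_eq.
by apply: (near_chart_dom (chart_atP p)) => q cq; rewrite frameK.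
Qed.

Lemma bracket_frame p u v :
  bracket (frame (chart_at p) u) (frame (chart_at p) v) p = 0.
Proof.
apply: etrans (congr2 (fun a b => a - b) (dfun_comp_frame p v _)
  (dfun_comp_frame p u _)) _.
exact: subrr.
Qed.

Lemma torsionE p u v : torsion nabla p u v =
  nabla p u (frame (chart_at p) v) - nabla p v (frame (chart_at p) u).
Proof. by rewrite /torsion bracket_frame subr0. Qed.

(* Both brackets in L_X A are expressed by nabla and its Christoffel symbols
   in the chart at p. *)
Lemma lie_endo_nabla (A : M -> E -> E) (X : M -> E) p v (c := chart_at p) :
  linear (A p) -> smooth_vf_at p X ->
  smooth_vf_at p (fun q => A q (frame c v q)) ->
  lie_endo X A p v =
    nabla p (X p) (fun q => A q (frame c v q))
    - nabla p (X p) (frame c (A p v))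
    - (nabla p (A p v) X - nabla p (A p v) (frame c (X p)))
    + A p (nabla p v X - nabla p v (frame c (X p))).
Proof.
move=> Alin Xs As; have cp : ch_dom c p := chart_atP p.
have coordK Z u : smooth_vf_at p Z ->
    nabla p u Z - nabla p u (frame c (Z p)) = dfun (fun q =>
      comp c q (Z q)) p u.
  by move=> Zs; apply/eqP; rewrite subr_eq; apply/eqP; exact: nabla_coord.
have fv : frame c v p = v by exact: frame_chart_at.
have e1 := coordK _ (X p) As; rewrite /= fv in e1.
have e2 u : dfun (fun q => comp c q (X q)) p u =
    nabla p u X - nabla p u (frame c (X p)) by exact: esym (coordK X u Xs).
have b1 : bracket X (fun q => A q (frame c v q)) p =
    nabla p (X p) (fun q => A q (frame c v q)) - nabla p (X p) (frame c (A p v))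
    - (nabla p (A p v) X - nabla p (A p v) (frame c (X p))).
  apply: (congr2 (fun a b => a - b) (esym e1)).
  exact: etrans (congr1 (fun u => dfun _ p (A p u)) fv) (e2 _).
have b2 : bracket X (frame c v) p = - (nabla p v X - nabla p v (frame c (X p))).
  apply: etrans (congr2 (fun a b => a - b) (dfun_comp_frame p v (X p))
    (etrans (congr1 (dfun _ p) fv) (e2 v))) _.
  exact: sub0r.
apply: etrans (congr2 (fun a b => a - A p b) b1 b2) _.
by rewrite (linear_funN Alin) opprK.
Qed.

End Christoffel.

(** * Derivatives along curves *)

Section AlongCurves.
Context {R : realType} {E : normedModType R} {fE : finite_dim E}.
Context {M : manifold E}.
Implicit Types (p : M) (gamma : R -> M) (V : R -> E).

(** Continuity keeps the curve in the chart domain for small times. Derivability of the coordinate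
    expression cannot replace it, since [ch_map] is arbitrary off the domain. *)
Definition derivable_curve gamma : Prop := {for 0, continuous gamma} /\
  derivable (ch_map (chart_at (gamma 0)) \o gamma) 0 1.

Lemma near_curve_dom gamma (P : R -> Prop) : derivable_curve gamma ->
  (forall t, ch_dom (chart_at (gamma 0)) (gamma t) -> P t) ->
  \forall t \near (0 : R), P t.
Proof.
move=> [gc _] H; have [oc c0] := chart_at_open (gamma 0).
have N : \forall t \near (0 : R), ch_dom (chart_at (gamma 0)) (gamma t).
  exact: gc _ (open_nbhs_nbhs (conj oc c0)).
by apply: filterS N => t; exact: H.
Qed.

Lemma curve_fun {F : normedModType R} (f : M -> F) gamma :
  derivable_curve gamma ->
  differentiable (f \o ch_inv (chart_at (gamma 0)))
    (ch_map (chart_at (gamma 0)) (gamma 0)) ->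
  is_derive (0 : R) 1 (f \o gamma) (dfun f (gamma 0) (velocity gamma 0)).
Proof.
move=> gd fd; set c := chart_at (gamma 0).
have [_ /derivable1_diffP dg] := gd.
apply: (near_eq_is_derive (f := (f \o ch_inv c) \o (ch_map c \o gamma))).
  by apply: (near_curve_dom gd) => t ct /=; rewrite (ch_mapK ct).
split; first by apply: diff_derivable; exact: differentiable_comp.
by rewrite (derive_comp _ dg fd) dfunE /velocity derive1E.
Qed.

(* The product rule for a field B of linear maps, in a fixed chart. *)
Lemma tensor_along_curve {F : normedModType R} (B : M -> E ->
  F) gamma p V (V' : E)
    (c := chart_at p) :
  gamma 0 = p -> derivable_curve gamma ->
  (forall q, ch_dom c q -> linear (B q)) ->
  (forall u, differentiable ((fun q => B q (frame c u q)) \o ch_inv c)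
    (ch_map c p)) ->
  is_derive (0 : R) 1 (fun t => comp c (gamma t) (V t)) V' ->
  is_derive (0 : R) 1 (fun t => B (gamma t) (V t))
    (B p V' + dfun (fun q => B q (frame c (V 0) q)) p (velocity gamma 0)).
Proof.
move=> pE; rewrite {}/c; case: p / pE; set c := chart_at (gamma 0).
move=> gd Blin Bd Vd; have [m [e [a [ac aE]]]] := fE.
have c0 : ch_dom c (gamma 0) := chart_atP _.
have [Vd1 Vd2] := Vd.
pose f i q := B q (frame c (e i) q).
pose g i t := a i (comp c (gamma t) (V t)).
have gD i : is_derive (0:R) 1 (g i) (a i V').
  by have := derive_linear_comp (ac i) Vd1; rewrite Vd2.
have fD i : is_derive (0:R) 1 (f i \o gamma) (dfun (f i) (gamma 0) (velocity
  gamma 0)).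
  by apply: curve_fun => //; exact: Bd.
apply: (near_eq_is_derive (f := \sum_i (fun t => g i t *: f i (gamma t)))).
  apply: (near_curve_dom gd) => t ct.
  rewrite fct_sumE -[in RHS](compK (V t) ct) [in RHS](aE (comp c _ _)).
  rewrite (linear_fun_sum (frame_linear ct)).
  by rewrite (linear_fun_sum (Blin _ ct)).
apply: is_derive_eq.
  apply: is_derive_sum => i; apply: is_derive_scale.
  - by have [/derivable1_diffP/differentiable_continuous + _] := fD i.
  - by have [] := gD i.
  - by have [] := fD i.
have dlin : linear (fun u => dfun (fun q => B q (frame c u q)) (gamma 0)
  (velocity gamma 0)).
  move=> k u v.
  have Bku : differentiable ((fun q => k *: B q (frame c u q)) \o ch_inv c)
      (ch_map c (gamma 0)) by exact: differentiableZ (Bd u).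
  rewrite (dfun_near_eq (g := fun q => k *: B q (frame c u q) + B q (frame c v
    q))).
    rewrite (dfunD _ c0 Bku (Bd v)) (dfun_chart _ c0 Bku) (dfun_chart _ c0 (Bd
      u)).
    congr (_ + _); exact: (deriveZ k (diff_derivable (Bd u))).
  by apply: (near_chart_dom c0) => q cq; rewrite frame_linear // Blin.
rewrite big_split /= [in RHS](aE V') (linear_fun_sum (Blin _ c0)).
rewrite -[in RHS](comp_chart_at (gamma 0) (V 0)) [in RHS](aE (comp _ _ _)).
apply: etrans (congr2 +%R _ _) (congr1 (+%R _) (esym (linear_fun_sum dlin _
  _))).
  apply: eq_bigr => i _; have [_ ->] := gD i.
  by rewrite /f frame_chart_at.
apply: eq_bigr => i _.
by have [_ ->] := fD i.
Qed.

End AlongCurves.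

(** * Bilinearity of the exterior derivative *)

Section ExteriorDerivative.
Context {R : realType} {E : normedModType R} {fE : finite_dim E}.
Context {M : manifold E} {alpha : M -> E -> R}.
Implicit Types (c : chart M) (p : M) (u v : E).

Lemma ext_d_antisym p u v : ext_d alpha p u v = - ext_d alpha p v u.
Proof. by rewrite /ext_d opprB. Qed.

(** The assumptions are local, rather than [is_oneform], so that the lemma also covers [df o j] for
    a function [f] under control near [p] only. *)
Lemma ext_d_linear_l p v (c := chart_at p) :
  (\forall q \near p, scalar (alpha q)) ->
  (forall u, differentiable ((fun q => alpha q (frame c u q)) \o ch_inv c)
    (ch_map c p)) ->
  scalar (fun u => ext_d alpha p u v).
Proof.
move=> al fd k u u'; rewrite /ext_d.
have cp : ch_dom c p := chart_atP p.
pose f w q := alpha q (frame c w q).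
have ku : differentiable ((fun q => k * f u q) \o ch_inv c) (ch_map c p).
  exact: differentiableZ (fd u).
have e1 : dfun (f v) p (k *: u + u') = k * dfun (f v) p u + dfun (f v) p u'.
  exact: (dfun_linear cp (fd v) k u u').
have e2 : dfun (f (k *: u + u')) p v = k * dfun (f u) p v + dfun (f u') p v.
  transitivity (dfun (fun q => k * f u q + f u' q) p v).
    apply: dfun_near_eq.
    have cn : \forall q \near p, ch_dom c q by exact: (near_chart_dom cp).
    by apply: filterS2 al cn => q aq cq; rewrite /f frame_linear // aq.
  apply: etrans (dfunD _ cp ku (fd u')) _.
  apply: (congr1 (+%R^~ _)); apply: etrans (dfun_chart _ cp ku) _.
  apply: etrans (deriveZ k (diff_derivable (fd u))) _.
  exact: congr1 (esym (dfun_chart _ cp (fd u))).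
apply: etrans (congr2 (fun a b : R => a - b) e1 e2) _.
by rewrite opprD addrACA -mulrBr.
Qed.

Hypothesis ha : is_oneform alpha.

Lemma oneform_frame_differentiable c p v : ch_dom c p ->
  differentiable ((fun q => alpha q (frame c v q)) \o ch_inv c) (ch_map c p).
Proof.
move=> cp; apply: (smooth_fun_differentiable (ch_dom_open c) cp cp).
exact: ha.2.
Qed.

Lemma ext_d_oneform_linear_l p v : scalar (fun u => ext_d alpha p u v).
Proof.
apply: ext_d_linear_l.
  by apply: filterS (@filterT _ _ _) => q _; exact: ha.1.
by move=> u; apply: oneform_frame_differentiable; exact: chart_atP.
Qed.

End ExteriorDerivative.

(** * The Reeb field and the contact triad connection *)

Section TriadAlgebra.
Context {R : realType} {n : nat}.
Local Notation E := 'rV[R]_(n.*2.+1).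
Context {Q : manifold E} {lam : Q -> E -> R} {J : Q -> E -> E} {X : Q -> E}.
Hypothesis hQ : contact_triad lam J X.
Implicit Types (p : Q) (u v : E).
Local Notation proj := (proj_xi lam X).

Lemma lam_oneform : is_oneform lam.
Proof. by case: (triad_contact hQ). Qed.

Lemma lam_scalar p : scalar (lam p).
Proof. exact: lam_oneform.1. Qed.

Lemma lam0 p : lam p 0 = 0. Proof. exact: linear_fun0 (lam_scalar p). Qed.

Lemma lamD p u v : lam p (u + v) = lam p u + lam p v.
Proof. exact: linear_funD (lam_scalar p) u v. Qed.

Lemma lamZ p k u : lam p (k *: u) = k * lam p u.
Proof. exact: linear_funZ (lam_scalar p) k u. Qed.

Lemma lamN p u : lam p (- u) = - lam p u.
Proof. exact: linear_funN (lam_scalar p) u. Qed.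

Lemma lamX p : lam p (X p) = 1.
Proof. by have [_ + _] := triad_reeb hQ; exact. Qed.

Lemma J_linear p : linear (J p).
Proof. exact: (triad_J hQ).1. Qed.

Lemma J0 p : J p 0 = 0. Proof. exact: linear_fun0 (J_linear p). Qed.

Lemma JD p u v : J p (u + v) = J p u + J p v.
Proof. exact: linear_funD (J_linear p) u v. Qed.

Lemma JZ p k u : J p (k *: u) = k *: J p u.
Proof. exact: linear_funZ (J_linear p) k u. Qed.

Lemma JN p u : J p (- u) = - J p u.
Proof. exact: linear_funN (J_linear p) u. Qed.

Lemma JX p : J p (X p) = 0.
Proof. exact: triad_J_reeb hQ p. Qed.

Lemma lam_proj p v : lam p (proj p v) = 0.
Proof. by rewrite /proj_xi lamD lamN lamZ lamX mulr1 subrr. Qed.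

Lemma J_proj p v : J p (proj p v) = J p v.
Proof. by rewrite /proj_xi JD JN JZ JX scaler0 oppr0 addr0. Qed.

Lemma lam_J p v : lam p (J p v) = 0.
Proof.
rewrite -J_proj.
have : (J p @` [set v | lam p v = 0]) (J p (proj p v)).
  by exists (proj p v) => //; exact: lam_proj.
by rewrite (triad_J_xi hQ).
Qed.

Lemma proj_id p v : lam p v = 0 -> proj p v = v.
Proof. by move=> v0; rewrite /proj_xi v0 scale0r subr0. Qed.

Lemma proj_J p v : proj p (J p v) = J p v.
Proof. by rewrite proj_id // lam_J. Qed.

Lemma proj_linear p : linear (proj p).
Proof.
move=> k u v; rewrite /proj_xi lamD lamZ.
by apply/rowP => i; rewrite !mxE; ring.
Qed.

Lemma projD p u v : proj p (u + v) = proj p u + proj p v.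
Proof. exact: linear_funD (proj_linear p) u v. Qed.

Lemma projZ p k u : proj p (k *: u) = k *: proj p u.
Proof. exact: linear_funZ (proj_linear p) k u. Qed.

Lemma projN p u : proj p (- u) = - proj p u.
Proof. exact: linear_funN (proj_linear p) u. Qed.

Lemma projX p : proj p (X p) = 0.
Proof. by rewrite /proj_xi lamX scale1r subrr. Qed.

Lemma proj_dec p v : v = proj p v + lam p v *: X p.
Proof. by rewrite /proj_xi subrK. Qed.

Lemma JJ p v : J p (J p v) = - proj p v.
Proof. by rewrite -(J_proj p v) (triad_J_sq hQ) // lam_proj. Qed.

Lemma smooth_reeb p : smooth_vf_at p X.
Proof.
have [Xs _ _] := triad_reeb hQ.
by exists setT => //; split; [exact: openT|].
Qed.

Lemma smooth_J_frame c p v : ch_dom c p -> smooth_vf_at p (fun q =>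
  J q (frame c v q)).
Proof.
move=> cp; exists (ch_dom c); first by split; [exact: ch_dom_open|].
exact: (triad_J hQ).2.
Qed.

Lemma smooth_lam_frame c p v : ch_dom c p -> smooth_fun_at p (fun q =>
  lam q (frame c v q)).
Proof.
move=> cp; exists (ch_dom c); first by split; [exact: ch_dom_open|].
exact: lam_oneform.2.
Qed.

Lemma ext_d_lam_linear_l p v : scalar (fun u => ext_d lam p u v).
Proof. exact: (ext_d_oneform_linear_l lam_oneform). Qed.

Lemma ext_d_lam0 p u : ext_d lam p u 0 = 0.
Proof.
have H : ext_d lam p 0 u = 0 := linear_fun0 (ext_d_lam_linear_l p u).
by rewrite ext_d_antisym H oppr0.
Qed.

Lemma ext_d_proj p u v : ext_d lam p (proj p u) v = ext_d lam p u v.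
Proof.
have [_ _ Xd] := triad_reeb hQ.
have -> : proj p u = (- lam p u) *: X p + u by rewrite /proj_xi scaleNr addrC.
by rewrite ext_d_lam_linear_l Xd mulr0 add0r.
Qed.

End TriadAlgebra.

(** * The covariant derivative of the Reeb field *)

Section TriadConnection.
Context {R : realType} {n : nat}.
Local Notation E := 'rV[R]_(n.*2.+1).
Context {Q : manifold E} {lam : Q -> E -> R} {J : Q -> E -> E} {X : Q -> E}.
Hypothesis hQ : contact_triad lam J X.
Context {nabla : Q -> E -> (Q -> E) -> E}.
Hypothesis hn : triad_connection lam J X nabla.
Implicit Types (p : Q) (u v : E).
Local Notation proj := (proj_xi lam X).
Let nablaP := tc_connection hn.

(** The Hermitian axioms concern sections of xi, and a coordinate field is not one. Its xi part is,
    and the Leibniz rule accounts for the remaining multiple of [X]. *)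
Lemma xi_part_frame p v (c := chart_at p) (f := fun q => lam q (frame c v q)) :
  xi_section_at lam p (fun q => proj q (frame c v q)) /\
  forall u, nabla p u (frame c v) =
    nabla p u (fun q => proj q (frame c v q)) + (dfun f p u *: X p + f p *:
      nabla p u X).
Proof.
have cp : ch_dom c p := chart_atP p.
have fs : smooth_fun_at p f by exact: (smooth_lam_frame hQ).
have Vs : smooth_vf_at p (frame c v) by exact: smooth_vf_at_frame.
have Xs : smooth_vf_at p X := smooth_reeb hQ p.
have fXs : smooth_vf_at p (fun q => f q *: X q)
  by exact: (smooth_vf_at_scale fs Xs).
have NfXs : smooth_vf_at p (fun q => (-1) *: (f q *: X q)).
  exact: (smooth_vf_at_scale (smooth_fun_at_cst p (-1)) fXs).
have Zs : smooth_vf_at p (fun q => proj q (frame c v q)).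
  have -> : (fun q => proj q (frame c v q)) = fun q =>
    frame c v q + (-1) *: (f q *: X q).
    by apply/funext => q; rewrite scaleN1r.
  exact: (smooth_vf_at_add Vs NfXs).
split.
  split; first exact: Zs.
  by apply: (near_chart_dom cp) => q _; exact: (lam_proj hQ).
move=> u.
apply: etrans (congr1 (+%R _) (nabla_leibniz nablaP u fs Xs)).
apply: etrans (nabla_add nablaP u Zs fXs).
by congr (nabla p u _); apply/funext => q; rewrite /proj_xi subrK.
Qed.

(** The Reeb coefficient of the coordinate field vanishes at [p] because [v] lies in xi. Its
    derivative contributes a multiple of [X], which [J] kills. *)
Lemma nabla_J_frame p u v (c := chart_at p) : lam p v = 0 ->
  proj p (nabla p u (fun q => J q (frame c v q))) = J p (nabla p u (frame c v)).
Proof.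
move=> v0; have [Zx nV] := xi_part_frame p v.
have := tc_hermitian_J hn u Zx; rewrite /nabla_pi (J_proj hQ).
have -> : (fun q => J q (proj q (frame c v q))) = fun q => J q (frame c v q).
  by apply/funext => q; rewrite (J_proj hQ).
move=> ->; rewrite nV frame_chart_at v0 scale0r addr0.
by rewrite (JD hQ) (JZ hQ) (JX hQ) scaler0 addr0.
Qed.

(** Differentiate [g (J V, X) = 0] along [X]: the metric axiom and [nabla_X X = 0] leave
    [g (nabla_X (J V), X)], which is the left-hand side. *)
Lemma lam_nabla_reeb_J p v (c := chart_at p) :
  lam p (nabla p (X p) (fun q => J q (frame c v q))) = 0.
Proof.
have cp : ch_dom c p := chart_atP p.
have := tc_metric hn (X p) (smooth_J_frame hQ v cp) (smooth_reeb hQ p).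
rewrite /triad_metric (tc_geodesic hn) (JX hQ) !(J0 hQ) !(ext_d_lam0 hQ).
rewrite (lam_J hQ) (lamX hQ) (lam0 hQ) mulr0 mulr1 !add0r !addr0 => <-.
apply: etrans _ (dfun_cst (0 : R) p (X p)).
apply: (congr1 (fun f => dfun f p (X p))); apply/funext => q.
by rewrite (JX hQ) (ext_d_lam0 hQ) (lam_J hQ) mul0r addr0.
Qed.

Lemma nabla_reeb_coord p v : nabla p v X =
  dfun (fun q => comp (chart_at p) q (X q)) p v + nabla p v (frame (chart_at p)
    (X p)).
Proof. exact: (nabla_coord nablaP _ (smooth_reeb hQ p)). Qed.

Lemma torsion_reeb p v :
  nabla p (X p) (frame (chart_at p) v) = nabla p v (frame (chart_at p) (X p)).
Proof.
by apply/eqP; rewrite -subr_eq0 -torsionE; apply/eqP;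
  exact: (tc_torsion_reeb hn).
Qed.

Lemma nabla_reeb_linear p : linear (fun v => nabla p v X).
Proof. exact: (nabla_linear nablaP (smooth_reeb hQ p)). Qed.

Lemma nabla_reeb_proj p v : nabla p (proj p v) X = nabla p v X.
Proof.
rewrite [in RHS](proj_dec (lam := lam) (X := X) p v) addrC nabla_reeb_linear.
by rewrite (tc_geodesic hn) scaler0 add0r.
Qed.

Lemma lam_nabla_reeb p v : lam p (nabla p v X) = 0.
Proof. by rewrite -nabla_reeb_proj (tc_reeb_xi hn) // (lam_proj hQ). Qed.

(** All Christoffel terms of [lie_endo_nabla] cancel. [nabla_X (J V)] has no Reeb part and so equals
    [J (nabla_X V)]; since [T (X, .) = 0], the arguments of each Christoffel term involving [X] may
    be exchanged. *)
Lemma lie_endo_reeb_J p v : lam p v = 0 ->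
  lie_endo X J p v = J p (nabla p v X) - nabla p (J p v) X.
Proof.
move=> v0; set c := chart_at p.
have cp : ch_dom c p := chart_atP p.
have H : nabla p (X p) (fun q => J q (frame c v q)) =
    J p (nabla p v (frame c (X p))).
  rewrite -torsion_reeb -nabla_J_frame // proj_id //; exact: lam_nabla_reeb_J.
apply: etrans (lie_endo_nabla nablaP (J_linear hQ p) (smooth_reeb hQ p)
  (smooth_J_frame hQ v cp)) _.
rewrite (JD hQ) (JN hQ) H (torsion_reeb p (J p v)) -/c.
set a := J p _; set b := nabla p (J p v) _; set d := nabla _ _ X;
  set e := J p _.
by apply/rowP => i; rewrite !mxE; ring.
Qed.

Lemma nabla_J_reeb p v : lam p v = 0 ->
  nabla p (J p v) X = - J p (nabla p v X).
Proof.
move=> v0; have /eqP := tc_reeb_J hn v0; rewrite subr_eq0 => /eqP ->.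
by rewrite (JJ hQ) opprK proj_id // lam_nabla_reeb.
Qed.

(** This is nabla X = (L_X J) J / 2 on xi. By [nabla_J_reeb] both terms of the commutator at [J p v]
    equal [nabla p v X], whence the 2. *)
Lemma lie_endo_reeb_JJ p v : lam p v = 0 ->
  lie_endo X J p (J p v) = 2 *: nabla p v X.
Proof.
move=> v0; rewrite lie_endo_reeb_J ?(lam_J hQ) // nabla_J_reeb //.
rewrite (JN hQ) (JJ hQ) opprK (JJ hQ) (proj_id v0) proj_id ?lam_nabla_reeb //.
rewrite (linear_funN (nabla_reeb_linear p)).
by rewrite opprK scaler_nat mulr2n.
Qed.

End TriadConnection.

(** * Smooth families of maps *)

Section MapsInCharts.
Context {R : realType} {E F : normedModType R}.
Context {fE : finite_dim E} {fF : finite_dim F}.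
Context {M : manifold E} {N : manifold F}.

Lemma line0 (p : M) v : line p v 0 = p.
Proof. by rewrite /line scale0r addr0 ch_mapK //; exact: chart_atP. Qed.

Lemma dmapE (f : M -> N) p v :
  dmap f p v = dfun (ch_map (chart_at (f p)) \o f) p v.
Proof. by rewrite /dmap /velocity line0. Qed.

Lemma near_line (p : M) v (P : M -> Prop) : (\forall q \near p, P q) ->
  \forall t \near (0 : R), P (line p v t).
Proof.
move=> Pp; have H : \forall x \near ch_map (chart_at p) p,
  P (ch_inv (chart_at p) x).
  exact: near_ch_inv (chart_atP p) Pp.
have lc : (fun t : R => ch_map (chart_at p) p + t *: v) @ (0 : R) -->
    ch_map (chart_at p) p.
  rewrite -[X in _ --> X]addr0 -[X in _ --> _ + X](scale0r v).
  by apply: cvgD; [exact: cvg_cst|apply: cvgZr_tmp; exact: cvg_id].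
exact: lc _ H.
Qed.

Lemma dmap_near_eq (f g : M -> N) p v :
  (\near p, f p = g p) -> dmap f p v = dmap g p v.
Proof.
move=> fg; rewrite !dmapE -(nbhs_singleton fg); apply: dfun_near_eq.
by apply: filterS fg => q /= ->.
Qed.

(** [dmap] is stored in [chart_at (f p)]. The transition map to [c] is inserted into the local
    expression, and its derivative is precisely [frame c]. *)
Lemma dmap_chart (f : M -> N) b c p v : ch_dom b p -> ch_dom c (f p) ->
  {for p, continuous f} ->
  differentiable (ch_map c \o f \o ch_inv b) (ch_map b p) ->
  comp c (f p) (dmap f p v) =
  'D_(comp b p v) (ch_map c \o f \o ch_inv b) (ch_map b p).
Proof.
move=> bp cfp fc fd; set g := _ \o _ \o _.
set c' := chart_at (f p); have c'fp : ch_dom c' (f p) := chart_atP _.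
have gp : g (ch_map b p) = ch_map c (f p) by rewrite /g /= ch_mapK.
have td : differentiable (ch_map c' \o ch_inv c) (g (ch_map b p)).
  by rewrite gp; exact: transition_differentiable.
have nE : \forall x \near ch_map b p,
    ((ch_map c' \o ch_inv c) \o g) x = ((ch_map c' \o f) \o ch_inv b) x.
  have : \forall q \near p, ch_dom c (f q).
    exact: (fc _ (open_nbhs_nbhs (conj (ch_dom_open c) cfp))).
  move=> /(near_ch_inv bp); apply: filterS => x /= cx.
  by rewrite /g /= ch_mapK.
have c'd : differentiable ((ch_map c' \o f) \o ch_inv b) (ch_map b p).
  by apply: (differentiable_near_eq nE); exact: differentiable_comp.
have dE : dmap f p v = frame c ('D_(comp b p v) g (ch_map b p)) (f p).
  rewrite dmapE -/c'; apply: etrans (dfun_chart v bp c'd) _.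
  apply: etrans (esym (near_eq_derive _ nE)) _.
  apply: etrans (derive_comp _ fd td) _.
  rewrite [RHS](frameE _ cfp).
  exact: (congr1 (fun x => derive (ch_map c' \o ch_inv c) x _) gp).
by rewrite dE frameK.
Qed.

Lemma velocity_chart (gamma : R -> M) c : ch_dom c (gamma 0) ->
  {for 0, continuous gamma} -> derivable (ch_map c \o gamma) 0 1 ->
  derivable_curve gamma /\
  comp c (gamma 0) (velocity gamma 0) = 'D_1 (ch_map c \o gamma) 0.
Proof.
move=> c0 gc /derivable1_diffP gd; set g := ch_map c \o gamma.
set c' := chart_at (gamma 0); have c'0 : ch_dom c' (gamma 0) := chart_atP _.
have td : differentiable (ch_map c' \o ch_inv c) (g 0).
  exact: transition_differentiable.
have nE : \forall t \near (0 : R),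
    ((ch_map c' \o ch_inv c) \o g) t = (ch_map c' \o gamma) t.
  have : \forall t \near (0 : R), ch_dom c (gamma t).
    exact: (gc _ (open_nbhs_nbhs (conj (ch_dom_open c) c0))).
  by apply: filterS => t ct; rewrite /g /= ch_mapK.
have c'd : differentiable (ch_map c' \o gamma) 0.
  by apply: (differentiable_near_eq nE); exact: differentiable_comp.
split; first by split=> //; exact/derivable1_diffP.
have -> : velocity gamma 0 = frame c ('D_1 g 0) (gamma 0).
  rewrite /velocity -/c' derive1E.
  apply: etrans (esym (near_eq_derive _ nE)) _.
  apply: etrans (derive_comp _ gd td) _.
  by apply/esym; exact: frameE.
by rewrite frameK.
Qed.

End MapsInCharts.

(** * The local expression of a family and its first derivatives *)

Section Variations.
Context {R : realType} {E F : normedModType R}.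
Context {fE : finite_dim E} {fF : finite_dim F}.
Context {M : manifold E} {N : manifold F}.
Variables (U : set M) (W : R -> M -> N) (e : R).
Hypothesis oU : open U.
Hypothesis Wc : forall s p, `|s| < e -> U p ->
  {for (s, p), continuous (fun q : R * M => W q.1 q.2)}.

Definition variation_dom b c := [set q : R * E |
  [/\ `|q.1| < e, (ch_map b @` (ch_dom b `&` U)) q.2
    & ch_dom c (W q.1 (ch_inv b q.2))]].

Definition variation_map b c (q : R * E) := ch_map c (W q.1 (ch_inv b q.2)).

Hypothesis Ws : forall b c, smooth_on (variation_dom b c) (variation_map b c).

Lemma variation_continuous s p : `|s| < e -> U p ->
  {for p, continuous (W s)} /\ {for s, continuous (W ^~ p)}.
Proof.
move=> se Up; split.
- have sc : (fun q : M => (s, q)) @ p --> (s, p).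
    by apply: (@cvg_pair _ _ _ _ (nbhs s) (nbhs p));
      [exact: cvg_cst|exact: cvg_id].
  exact: (cvg_comp _ _ sc (Wc se Up)).
- have sc : (fun t : R => (t, p)) @ s --> (s, p).
    by apply: (@cvg_pair _ _ _ _ (nbhs s) (nbhs p));
      [exact: cvg_id|exact: cvg_cst].
  exact: (cvg_comp _ _ sc (Wc se Up)).
Qed.

(** Joint continuity of [W] makes the third condition open in the pair; the rules for [Ck] all work
    on open sets. *)
Lemma variation_dom_open b c : open (variation_dom b c).
Proof.
rewrite openE => -[s x] [/= se bx cx]; rewrite /interior.
have [bi Ui xE] := ch_image_inv bx.
have fstc : (fun q : R * E => q.1) @ (s, x) --> s by exact: cvg_fst.
have sndc : (fun q : R * E => q.2) @ (s, x) --> x by exact: cvg_snd.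
have ic : {for x, continuous (ch_inv b)}.
  by apply: ch_inv_continuous; exists (ch_inv b x).
have c1 : \forall q \near (s, x), `|q.1| < e.
  have s1 : \forall t \near s, `|t| < e.
    by have := @norm_continuous _ R s; move/cvgr_lt; apply.
  exact: fstc _ s1.
have c2 : \forall q \near (s, x), (ch_map b @` (ch_dom b `&` U)) q.2.
  exact: sndc _ (open_nbhs_nbhs (conj (ch_image_open b oU) bx)).
have c3 : \forall q \near (s, x), ch_dom c (W q.1 (ch_inv b q.2)).
  have pc : (fun q : R * E => (q.1, ch_inv b q.2)) @ (s, x) --> (s, ch_inv b x).
    apply: (@cvg_pair _ _ _ _ (nbhs s) (nbhs (ch_inv b x))); first exact: fstc.
    exact: (cvg_comp _ _ sndc ic).
  have wc := cvg_comp _ _ pc (Wc se Ui).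
  exact: wc _ (open_nbhs_nbhs (conj (ch_dom_open c) cx)).
by apply: filterS3 c1 c2 c3 => q.
Qed.

Lemma variation_dom_mem b c s p : `|s| < e -> U p -> ch_dom b p ->
  ch_dom c (W s p) -> variation_dom b c (s, ch_map b p).
Proof. by move=> se Up bp cp; split=> //=; [exists p|rewrite ch_mapK]. Qed.

Lemma variation_dmap b c s p v : `|s| < e -> U p -> ch_dom b p ->
  ch_dom c (W s p) ->
  comp c (W s p) (dmap (W s) p v) =
  'D_(0, comp b p v) (variation_map b c) (s, ch_map b p).
Proof.
move=> se Up bp cp; have [Wsc _] := variation_continuous se Up.
have Fd : differentiable (variation_map b c) (s, ch_map b p).
  exact: (Ck_differentiable (@variation_dom_open b c) (@Ws b c 1)
    (variation_dom_mem se Up bp cp)).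
apply: etrans (dmap_chart v bp cp Wsc _) _; first exact: differentiable_fix_fst
  Fd.
exact: derive_snd.
Qed.

Lemma variation_velocity b c p : 0 < e -> U p -> ch_dom b p ->
  ch_dom c (W 0 p) ->
  derivable_curve (W ^~ p) /\
  comp c (W 0 p) (velocity (W ^~ p) 0) =
  'D_(1, 0) (variation_map b c) (0, ch_map b p).
Proof.
move=> e0 Up bp cp.
have se : `|0 : R| < e by rewrite normr0.
have [_ Wpc] := variation_continuous se Up.
have Fd : differentiable (variation_map b c) (0, ch_map b p).
  exact: (Ck_differentiable (@variation_dom_open b c) (@Ws b c 1)
    (variation_dom_mem se Up bp cp)).
have Wd := differentiable_fix_snd Fd.
have WE : (fun s => variation_map b c (s, ch_map b p)) = ch_map c \o W ^~ p.
  by apply/funext => s; rewrite /variation_map /= ch_mapK.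
rewrite WE in Wd.
have [|? ->] := velocity_chart cp Wpc; first exact: diff_derivable.
by split=> //; rewrite -WE derive_fst.
Qed.

End Variations.

(** * The mixed second derivative of a family *)

Section VariationDerivatives.
Context {R : realType} {E F : normedModType R}.
Context {fE : finite_dim E} {fF : finite_dim F}.
Context {M : manifold E} {N : manifold F}.
Variables (U : set M) (w : M -> N) (Y : M -> F) (W : R -> M -> N) (e : R).
Hypothesis oU : open U.
Hypothesis e0 : 0 < e.
Hypothesis Wc : forall s p, `|s| < e -> U p ->
  {for (s, p), continuous (fun q : R * M => W q.1 q.2)}.
Hypothesis Ws : forall b c, smooth_on (variation_dom U W e b c) (variation_map W
  b c).
Hypothesis W0 : forall p, U p -> W 0 p = w p.
Hypothesis WY : forall p, U p -> velocity (W ^~ p) 0 = Y p.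
Lemma dmap_variation0 p v : U p -> dmap (W 0) p v = dmap w p v.
Proof.
move=> Up; apply: dmap_near_eq.
by apply: filterS (open_nbhs_nbhs (conj oU Up)) => q; exact: W0.
Qed.

Variables (z : M) (Uz : U z).
Let b := chart_at z.
Let c := chart_at (w z).
Let y0 := ch_map b z.
Let G := variation_map W b c.

Let e0' : `|0 : R| < e. Proof. by rewrite normr0. Qed.

Let bz : ch_dom b z. Proof. exact: chart_atP. Qed.

Let cz : ch_dom c (W 0 z). Proof. by rewrite W0 //; exact: chart_atP. Qed.

Let oD : open (variation_dom U W e b c).
Proof. exact: variation_dom_open. Qed.

Let z0 : variation_dom U W e b c (0, y0).
Proof. exact: variation_dom_mem. Qed.

(** The second-order term common to the derivative in [s] of dw_s(v) and to the derivative of [Y]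
    along the line with velocity [v]. *)
Definition mixed_derivative v := 'D_(1, 0) ('D_(0, v) G) (0, y0).

Lemma variation_near_dom : \forall s \near (0 : R),
  `|s| < e /\ ch_dom c (W s z).
Proof.
have [_ Wz] := variation_continuous Wc e0' Uz.
have h1 : \forall s \near (0 : R), `|s| < e by exact: nbhs0_lt.
have h2 : \forall s \near (0 : R), ch_dom c (W s z).
  exact: Wz _ (open_nbhs_nbhs (conj (ch_dom_open c) cz)).
by apply: filterS2 h1 h2.
Qed.

Lemma variation_dmap_derive v : is_derive (0 : R) 1
  (fun s => comp c (W s z) (dmap (W s) z v)) (mixed_derivative v).
Proof.
have Gd : differentiable ('D_(0, v) G) (0, y0).
  exact: (Ck_differentiable oD (Ck_derive (0, v) (@Ws b c 2)) z0).
apply: (near_eq_is_derive (f := fun s => 'D_(0, v) G (s, y0))).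
  apply: filterS variation_near_dom => s [se cs].
  apply/esym; apply: etrans (variation_dmap oU Wc Ws v se Uz bz cs) _.
  by rewrite comp_chart_at.
split; last exact: (derive_fst ('D_(0, v) G)).
by apply: diff_derivable; exact: differentiable_fix_snd Gd.
Qed.

Lemma near_line_chart v : \forall t \near (0 : R),
  [/\ U (line z v t), ch_dom b (line z v t), ch_dom c (w (line z v t))
    & ch_map b (line z v t) = t *: v + y0].
Proof.
have lc : (fun t : R => y0 + t *: v) @ (0 : R) --> y0.
  rewrite -[X in _ --> X]addr0 -[X in _ --> _ + X](scale0r v).
  by apply: cvgD; [exact: cvg_cst|apply: cvgZr_tmp; exact: cvg_id].
have h1 : \forall t \near (0 : R), (ch_map b @` (ch_dom b `&` U)) (y0 + t *: v).
  exact: lc _ (near_ch_image oU bz Uz).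
have [Wz _] := variation_continuous Wc e0' Uz.
have h2 : \forall t \near (0 : R), ch_dom c (W 0 (line z v t)).
  have h0 : \forall q \near z, ch_dom c (W 0 q).
    exact: Wz _ (open_nbhs_nbhs (conj (ch_dom_open c) cz)).
  exact: near_line h0.
apply: filterS2 h1 h2 => t /ch_image_inv[bt Ut tE] ct.
by split; [exact: Ut|exact: bt|rewrite -W0|rewrite [RHS]addrC].
Qed.

(** Near [z] the components of [Y] are the [s]-derivative of [G] at [s = 0], so the second
    derivative arises in the opposite order, and Schwarz exchanges the two. *)
Lemma variation_field_derive v : is_derive (0 : R) 1
  (fun t => comp c (w (line z v t)) (Y (line z v t))) (mixed_derivative v).
Proof.
have Gd : differentiable ('D_(1, 0) G) (0, y0).
  exact: (Ck_differentiable oD (Ck_derive ((1, 0) : R * E) (@Ws b c 2)) z0).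
have Gd' := differentiable_fix_fst Gd.
apply: (near_eq_is_derive (f := fun t : R => 'D_(1, 0) G (0, t *: v + y0))).
  apply: filterS (near_line_chart v) => t [Ut bt ct <-].
  have cWt : ch_dom c (W 0 (line z v t)) by rewrite W0.
  have [_] := variation_velocity oU Wc Ws e0 Ut bt cWt.
  by rewrite W0 // WY // => ->.
apply: is_derive_eq.
  apply: (is_derive_line (f := fun y => 'D_(1, 0) G (0, y))).
  by rewrite scale0r add0r; exact: diff_derivable.
rewrite scale0r add0r; apply: etrans (derive_snd ('D_(1, 0) G) 0 y0 v) _.
exact: (schwarz ((1, 0) : R * E) (0, v) oD z0 (@Ws b c 2)).
Qed.

Lemma variation_line_curve v : derivable_curve (fun t => w (line z v t)).
Proof.
have Gd : differentiable G (0, y0).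
  exact: (Ck_differentiable oD (@Ws b c 1) z0).
have Gd' := differentiable_fix_fst Gd.
have [Wz _] := variation_continuous Wc e0' Uz.
have wz : {for z, continuous w}.
  apply: continuous_near_eq Wz.
  by apply: filterS (open_nbhs_nbhs (conj oU Uz)) => q; exact: W0.
have l0 : line z v 0 = z := line0 z v.
have cl : ch_dom c (w (line z v 0)) by rewrite l0; exact: chart_atP.
have wl : {for 0, continuous (fun t => w (line z v t))}.
  move=> A; rewrite l0 => zA.
  have h0 : \forall q \near z, A (w q) by exact: wz.
  exact: near_line h0.
have gd : derivable (fun t : R => G (0, t *: v + y0)) (0 : R) 1.
  have Gv : derivable (fun y => G (0, y)) (0 *: v + y0) v.
    by rewrite scale0r add0r; exact: diff_derivable.
  by have [] := is_derive_line Gv.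
have wd : derivable (ch_map c \o (fun t => w (line z v t))) 0 1.
  apply: near_eq_derivable gd.
  apply: filterS (near_line_chart v) => t [Ut bt ct <-].
  by rewrite /G /variation_map /= ch_mapK // W0.
exact: (velocity_chart cl wl wd).1.
Qed.

Lemma variation_curve : derivable_curve (W ^~ z).
Proof. by have [] := variation_velocity oU Wc Ws e0 Uz bz cz. Qed.

End VariationDerivatives.

(** * The linearization of the Cauchy-Riemann operator *)

Section ProjectionAlongCurves.
Context {R : realType} {E : normedModType R} {fE : finite_dim E}.
Context {M : manifold E} {alpha : M -> E -> R} {X : M -> E}.
Hypothesis ha : is_oneform alpha.
Hypothesis Xs : forall p, smooth_vf_at p X.

(** The number [l], the derivative of [alpha (V)], is left unspecified: it multiplies [X] and
    disappears under projection. *)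
Lemma proj_along_curve (gamma : R -> M) (V : R -> E) (V' : E)
    (c := chart_at (gamma 0)) :
  derivable_curve gamma ->
  is_derive (0 : R) 1 (fun t => comp c (gamma t) (V t)) V' ->
  exists l, is_derive (0 : R) 1
    (fun t => comp c (gamma t) (V t - alpha (gamma t) (V t) *: X (gamma t)))
    (V' - (l *: X (gamma 0) + alpha (gamma 0) (V 0) *:
           dfun (fun q => comp c q (X q)) (gamma 0) (velocity gamma 0))).
Proof.
move=> gd Vd; have c0 : ch_dom c (gamma 0) := chart_atP _.
have ad := tensor_along_curve erefl gd (fun q _ => ha.1 q)
  (fun u => oneform_frame_differentiable ha u c0) Vd.
have Xd := curve_fun gd (smooth_vf_at_coord (fE := fE) c0 (Xs _)).
set l := _ + _ in ad; exists l.
apply: (near_eq_is_derive (f := (fun t => comp c (gamma t) (V t)) -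
  (fun t => alpha (gamma t) (V t) *: comp c (gamma t) (X (gamma t))))).
  apply: (near_curve_dom gd) => t ct /=.
  rewrite (linear_funD (comp_linear ct)) (linear_funN (comp_linear ct)).
  by rewrite (linear_funZ (comp_linear ct)).
apply: is_deriveB; apply: is_derive_eq.
  apply: is_derive_scale.
  - by have [/derivable1_diffP/differentiable_continuous + _] := Xd.
  - by have [] := ad.
  - by have [] := Xd.
have [_ ->] := ad; have [_ e2] := Xd.
apply: (congr2 +%R); first by rewrite comp_chart_at.
exact: congr1 e2.
Qed.

Lemma scaled_sum_along_curve (gamma : R -> M) (V1 V2 : R ->
  E) (D1 D2 : E) (k : R)
    (c := chart_at (gamma 0)) : derivable_curve gamma ->
  is_derive (0 : R) 1 (fun t => comp c (gamma t) (V1 t)) D1 ->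
  is_derive (0 : R) 1 (fun t => comp c (gamma t) (V2 t)) D2 ->
  is_derive (0 : R) 1 (fun t => comp c (gamma t) (k *: (V1 t + V2 t)))
    (k *: (D1 + D2)).
Proof.
move=> gd h1 h2; have D0 := is_deriveZ k (is_deriveD h1 h2).
apply: near_eq_is_derive D0.
apply: (near_curve_dom gd) => t ct; apply/esym.
apply: etrans (linear_funZ (comp_linear ct) _ _) _.
exact: congr1 (linear_funD (comp_linear ct) _ _).
Qed.

End ProjectionAlongCurves.

Section FirstLinearization.
Context {R : realType} {n : nat}.
Local Notation E := 'rV[R]_(n.*2.+1).
Context {Q : manifold E} {lam : Q -> E -> R} {J : Q -> E -> E} {X : Q -> E}.
Hypothesis hQ : contact_triad lam J X.
Context {nabla : Q -> E -> (Q -> E) -> E}.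
Hypothesis hn : triad_connection lam J X nabla.
Implicit Types (p : Q) (u v : E).
Local Notation proj := (proj_xi lam X).
Local Notation chr p u v := (nabla p u (frame (chart_at p) v)).
Let nablaP := tc_connection hn.

Lemma proj_nabla_reeb p u : proj p (nabla p u X) = nabla p u X.
Proof. by rewrite proj_id //; exact: (lam_nabla_reeb hQ hn). Qed.

(** From [V - lam V *: X]: the coordinate derivative of [X] and the Christoffel term of [X] combine
    into [nabla X], which already lies in xi, while the derivative of [lam V] is lost under the
    projection. *)
Lemma proj_derivative (gamma : R -> Q) p (V : R -> E) (V' : E) :
  gamma 0 = p -> derivable_curve gamma ->
  is_derive (0 : R) 1 (fun t => comp (chart_at p) (gamma t) (V t)) V' ->
  exists D : E, is_derive (0 : R) 1
    (fun t => comp (chart_at p) (gamma t) (proj (gamma t) (V t))) D /\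
    proj p (D + chr p (velocity gamma 0) (proj p (V 0))) =
    proj p (V' + chr p (velocity gamma 0) (V 0))
      - lam p (V 0) *: nabla p (velocity gamma 0) X.
Proof.
move=> pE; case: p / pE => gd Vd.
have [l D] := proj_along_curve (lam_oneform hQ) (smooth_reeb hQ) gd Vd.
eexists; split; first exact: D.
set p := gamma 0; set y := velocity gamma 0.
have chl : linear (fun u => chr p y u) by exact: christoffel_linear.
have E1 : chr p y (proj p (V 0)) = chr p y (V 0) - lam p (V 0) *: chr p y (X p).
  have e1 := linear_funD chl (V 0) (- (lam p (V 0) *: X p)).
  have e2 := linear_funN chl (lam p (V 0) *: X p).
  have e3 := linear_funZ chl (lam p (V 0)) (X p).
  exact: etrans e1 (congr1 (+%R _) (etrans e2 (congr1 -%R e3))).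
have alg A B dX K CP (a : R) : CP = A - a *: B -> K = dX + B -> proj p K = K ->
    proj p (V' - (l *: X p + a *: dX) + CP) = proj p (V' + A) - a *: K.
  move=> -> KE KP; rewrite -[in RHS]KP KE.
  rewrite !(projD hQ) !(projN hQ) !(projD hQ) !(projZ hQ) (projX hQ).
  by apply/rowP => i; rewrite !mxE; ring.
exact: alg E1 (nabla_reeb_coord hQ hn p y) (proj_nabla_reeb p y).
Qed.

Lemma cov_proj (gamma : R -> Q) p (V : R -> E) (V' : E) :
  gamma 0 = p -> derivable_curve gamma ->
  is_derive (0 : R) 1 (fun t => comp (chart_at p) (gamma t) (V t)) V' ->
  proj p (cov_curve nabla gamma (fun t => proj (gamma t) (V t)) 0) =
  proj p (V' + chr p (velocity gamma 0) (V 0))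
    - lam p (V 0) *: nabla p (velocity gamma 0) X.
Proof.
move=> pE gd Vd; have [D [Dd <-]] := proj_derivative pE gd Vd.
rewrite /cov_curve pE; apply: (congr1 (proj p)); apply: (congr1 (+%R^~ _)).
by rewrite derive1E; have [_ ->] := Dd.
Qed.

(** Compatibility of the projected connection with [J], carried over to fields along a curve. The
    product rule leaves a term that depends on [V 0] alone, and for it [nabla_J_frame] applies
    because [V 0] is in xi. *)
Lemma J_derivative (gamma : R -> Q) p (V : R -> E) (V' : E) :
  gamma 0 = p -> derivable_curve gamma -> lam p (V 0) = 0 ->
  is_derive (0 : R) 1 (fun t => comp (chart_at p) (gamma t) (V t)) V' ->
  exists D : E, is_derive (0 : R) 1
    (fun t => comp (chart_at p) (gamma t) (J (gamma t) (V t))) D /\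
    proj p (D + chr p (velocity gamma 0) (J p (V 0))) =
    J p (V' + chr p (velocity gamma 0) (V 0)).
Proof.
move=> pE; case: p / pE => gd V0 Vd.
set p := gamma 0; set c := chart_at p; set y := velocity gamma 0.
have cp : ch_dom c p := chart_atP p.
have Blin q : ch_dom c q -> linear (fun u => comp c q (J q u)).
  by move=> cq k u v; rewrite (J_linear hQ) (comp_linear cq).
have Bd u : differentiable ((fun q => comp c q (J q (frame c u q))) \o ch_inv c)
    (ch_map c p).
  exact: (smooth_vf_at_coord cp (smooth_J_frame hQ u cp)).
have D := tensor_along_curve erefl gd Blin Bd Vd.
eexists; split; first exact: D.
have JE := nabla_coord nablaP y (smooth_J_frame hQ (V 0) cp).
rewrite -/c frame_chart_at in JE.
have := nabla_J_frame hQ hn y V0; rewrite -/p -/c JE => H.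
rewrite -addrA (projD hQ) H comp_chart_at (proj_J hQ).
by rewrite -(JD hQ).
Qed.

(** To be used with [V1] and [V2] the images of [v] and [j v] under dw_s; the vectors [v] and [j v]
    themselves do not depend on [s]. *)
Lemma cov_dbar (gamma : R -> Q) p (V1 V2 : R -> E) (V1' V2' : E)
    (y := velocity gamma 0) :
  gamma 0 = p -> derivable_curve gamma ->
  is_derive (0 : R) 1 (fun t => comp (chart_at p) (gamma t) (V1 t)) V1' ->
  is_derive (0 : R) 1 (fun t => comp (chart_at p) (gamma t) (V2 t)) V2' ->
  proj p (cov_curve nabla gamma (fun t => 2^-1 *: (proj (gamma t) (V1 t) +
     J (gamma t) (proj (gamma t) (V2 t)))) 0) =
  2^-1 *: ((proj p (V1' + chr p y (V1 0)) - lam p (V1 0) *: nabla p y X) +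
     J p (proj p (V2' + chr p y (V2 0)) - lam p (V2 0) *: nabla p y X)).
Proof.
move=> pE; case: p / pE => gd V1d V2d; set p := gamma 0.
have [D1 [D1d H1]] := proj_derivative erefl gd V1d.
have [D2 [D2d H2]] := proj_derivative erefl gd V2d.
have xi0 : lam p (proj p (V2 0)) = 0 := lam_proj hQ p (V2 0).
have [D3 [D3d H3]] := J_derivative erefl gd xi0 D2d.
have chl : linear (fun u => chr p y u) by exact: christoffel_linear.
have Dd : is_derive (0 : R) 1 (fun t => comp (chart_at p) (gamma t)
   (2^-1 *: (proj (gamma t) (V1 t) + J (gamma t) (proj (gamma t) (V2 t)))))
   (2^-1 *: (D1 + D3)).
  exact: scaled_sum_along_curve gd D1d D3d.
have e1 : derive1 (fun t => comp (chart_at p) (gamma t)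
   (2^-1 *: (proj (gamma t) (V1 t) + J (gamma t) (proj (gamma t) (V2 t))))) 0 =
   2^-1 *: (D1 + D3).
  by rewrite derive1E; have [_ ->] := Dd.
have e2 := linear_funZ chl 2^-1 (proj p (V1 0) + J p (proj p (V2 0))).
have e3 := linear_funD chl (proj p (V1 0)) (J p (proj p (V2 0))).
apply: etrans (congr2 (fun a b => proj p (a + b)) e1
  (etrans e2 (congr1 ( *:%R _) e3))) _.
have alg (A B D D' : E) : proj p (2^-1 *: (D + D') + 2^-1 *: (A + B)) =
    2^-1 *: (proj p (D + A) + proj p (D' + B)).
  by rewrite -scalerDr (projZ hQ) addrACA [in LHS](projD hQ).
apply: etrans (alg _ _ _ _) _; apply: (congr1 ( *:%R _)).
apply: (congr2 +%R H1); apply: etrans H3 _.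
(* [H2] determines its vector only up to a multiple of [X], which [J] does not see. *)
exact: etrans (esym (J_proj hQ _ _)) (congr1 (J p) H2).
Qed.

End FirstLinearization.

Section FirstLinearizationFormula.
Context {R : realType} {n : nat}.
Local Notation E := 'rV[R]_(n.*2.+1).
Local Notation E2 := 'rV[R]_2.
Context {Q : manifold E} {lam : Q -> E -> R} {J : Q -> E -> E} {X : Q -> E}.
Hypothesis hQ : contact_triad lam J X.
Context {nabla : Q -> E -> (Q -> E) -> E}.
Hypothesis hn : triad_connection lam J X nabla.
Context {S : manifold E2}.
Variables (j : S -> E2 -> E2).
Variables (U : set S) (w : S -> Q) (Y : S -> E) (W : R -> S -> Q) (e : R).
Hypothesis oU : open U.
Hypothesis e0 : 0 < e.
Hypothesis Wc : forall s p, `|s| < e -> U p ->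
  {for (s, p), continuous (fun q : R * S => W q.1 q.2)}.
Hypothesis Ws : forall b c, smooth_on (variation_dom U W e b c) (variation_map W
  b c).
Hypothesis W0 : forall p, U p -> W 0 p = w p.
Hypothesis WY : forall p, U p -> velocity (W ^~ p) 0 = Y p.
Variables (z : S) (Uz : U z).
Implicit Types v : E2.
Local Notation proj := (proj_xi lam X).
Local Notation chr p u v := (nabla p u (frame (chart_at p) v)).
Let nablaP := tc_connection hn.
Let p := w z.
Let K u := nabla p u X.
Let m v := mixed_derivative w W z v.

Lemma nabla_pi_alongE v : nabla_pi_along lam X nabla w (sec_pi lam X w Y) z v =
  proj p (m v + chr p (dmap w z v) (Y z)) - lam p (Y z) *: K (dmap w z v).
Proof.
have l0 : line z v 0 = z := line0 z v.
have g0 : (fun t => w (line z v t)) 0 = p by rewrite /= l0.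
have Yd : is_derive (0 : R) 1
    (fun t => comp (chart_at p) (w (line z v t)) (Y (line z v t))) (m v).
  exact: (variation_field_derive oU e0 Wc Ws W0 WY Uz v).
have gd : derivable_curve (fun t => w (line z v t)).
  exact: (variation_line_curve oU e0 Wc Ws W0 Uz v).
have := cov_proj hQ hn g0 gd Yd; rewrite l0; exact.
Qed.

(** Since [T (X, .) = 0], the torsion does not change when [Y] replaces its xi part. *)
Lemma T_piE v : T_pi lam X nabla w (sec_pi lam X w Y) z v =
  proj p (chr p (Y z) (dmap w z v) - chr p (dmap w z v) (Y z)).
Proof.
set u := dmap w z v; set a := lam p (Y z).
have sE : sec_pi lam X w Y z = (- a) *: X p + Y z.
  by rewrite /sec_pi /proj_xi scaleNr addrC.
have chl : linear (fun u' => chr p u u') by exact: christoffel_linear.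
have fs : smooth_vf_at p (frame (chart_at p) u).
  by apply: smooth_vf_at_frame; exact: chart_atP.
have chl' : linear (fun u' => chr p u' u) by exact: nabla_linear.
have e1 := chl' (- a) (X p) (Y z).
have e2 := chl (- a) (X p) (Y z).
have tX := torsion_reeb hn p u.
rewrite /T_pi sE torsionE; apply: (congr1 (proj p)).
apply: etrans (congr2 (fun a b => a - b) e1 e2) _.
by rewrite /= tX opprD addrACA subrr add0r.
Qed.

Lemma nabla_reeb_sec_pi : nabla p (sec_pi lam X w Y z) X = K (Y z).
Proof. exact: (nabla_reeb_proj hQ hn). Qed.

Lemma B_opE v : B_op lam J X w (sec_pi lam X w Y) z v =
  - (lam p (dmap w z v) *: K (Y z)).
Proof.
rewrite /B_op (lie_endo_reeb_JJ hQ hn) ?(lam_proj hQ) // nabla_reeb_sec_pi.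
by rewrite scalerA mulNr mulrAC mulVf ?mul1r ?scaleNr // pnatr_eq0.
Qed.

(** The 2 of [lie_endo_reeb_JJ] cancels the 1/2 in [del_pi]; the minus sign there becomes a plus
    because nabla X anticommutes with [J]. *)
Lemma lie_del_piE v : lie_endo X J p (J p (del_pi lam J X j w z v)) =
  K (dmap w z v) + J p (K (dmap w z (j z v))).
Proof.
have Kl : linear K by exact: (nabla_reeb_linear hQ hn).
have Kp u : K (proj p u) = K u by exact: (nabla_reeb_proj hQ hn).
have KJ u : K (J p (proj p u)) = - J p (K u).
  rewrite -[in RHS]Kp; apply: (nabla_J_reeb hQ hn); exact: (lam_proj hQ).
rewrite (lie_endo_reeb_JJ hQ hn).
  rewrite -/(K _) /del_pi /dpi (linear_funZ Kl) (linear_funD Kl) (linear_funN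
    Kl).
  by rewrite Kp KJ opprK scalerA divff ?scale1r // pnatr_eq0.
by rewrite /del_pi /dpi (lamZ hQ) (lamD hQ) (lamN hQ) (lam_J hQ) (lam_proj hQ)
  subr0 mulr0.
Qed.

Lemma first_linearization v :
  DUpsilon1 lam J X nabla j W z v =
    dbar_nabla_pi lam J X nabla j w (sec_pi lam X w Y) z v
    + part01 J j w (T_pi lam X nabla w (sec_pi lam X w Y)) z v
    + part01 J j w (B_op lam J X w (sec_pi lam X w Y)) z v
    + (2^-1 * sec_lam lam w Y z) *:
        lie_endo X J (w z) (J (w z) (del_pi lam J X j w z v)).
Proof.
have g0 : (fun s => W s z) 0 = p by exact: W0.
have gd : derivable_curve (fun s => W s z).
  exact: (variation_curve oU e0 Wc Ws W0 Uz).
have Vd u : is_derive (0 : R) 1 (fun s => comp (chart_at p) (W s z) (dmap (W s)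
  z u)) (m u).
  exact: (variation_dmap_derive oU e0 Wc Ws W0 Uz u).
have := cov_dbar hQ hn g0 gd (Vd v) (Vd (j z v)).
have -> : velocity (fun s => W s z) 0 = Y z by exact: WY.
rewrite !(dmap_variation0 oU W0 _ Uz) => H.
rewrite /DUpsilon1 W0 //; apply: etrans H _.
(* [c1] and [c2] are the Christoffel terms of [Y] and dw(v) in the two orders, [c3] and [c4] those
   for [j v]: replacing [c1] by [c2] costs the torsion. The [b] terms are [B]. The [a] terms,
   present because the derivative on the right is that of the xi part of [Y], cancel against the
   last summand. *)
have alg (m1 m2 c1 c2 c3 c4 k k1 k2 : E) (a b b' : R) :
    2^-1 *: ((proj p (m1 + c1) - b *: k) + J p (proj p (m2 + c3) - b' *: k)) =
    2^-1 *: ((proj p (m1 + c2) - a *: k1) + J p (proj p (m2 + c4) - a *: k2))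
    + 2^-1 *: (proj p (c1 - c2) + J p (proj p (c3 - c4)))
    + 2^-1 *: (- (b *: k) + J p (- (b' *: k)))
    + (2^-1 * a) *: (k1 + J p k2).
  rewrite !(projD hQ) !(projN hQ) !(JD hQ) !(JN hQ) !(JD hQ) !(JN hQ) !(JZ hQ).
  by apply/rowP => i; rewrite !mxE; ring.
have eA := congr2 (fun a b => 2^-1 *: (a + J p b))
  (nabla_pi_alongE v) (nabla_pi_alongE (j z v)).
have eT := congr2 (fun a b => 2^-1 *: (a + J p b)) (T_piE v) (T_piE (j z v)).
have eB := congr2 (fun a b => 2^-1 *: (a + J p b)) (B_opE v) (B_opE (j z v)).
have eL := congr1 ( *:%R (2^-1 * sec_lam lam w Y z)) (lie_del_piE v).
apply: etrans _ (esym (congr2 +%R (congr2 +%R (congr2 +%R eA eT) eB) eL)).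
exact: alg.
Qed.

End FirstLinearizationFormula.

(** * The linearization of the exact part *)

Section PullbackVariation.
Context {R : realType} {E F : normedModType R}.
Context {fE : finite_dim E} {fF : finite_dim F}.
Context {M : manifold E} {N : manifold F} {lam : N -> F -> R}.
Hypothesis hl : is_oneform lam.
Variables (U : set M) (w : M -> N) (Y : M -> F) (W : R -> M -> N) (e : R).
Hypothesis oU : open U.
Hypothesis e0 : 0 < e.
Hypothesis Wc : forall s p, `|s| < e -> U p ->
  {for (s, p), continuous (fun q : R * M => W q.1 q.2)}.
Hypothesis Ws : forall b c, smooth_on (variation_dom U W e b c) (variation_map W
  b c).
Hypothesis W0 : forall p, U p -> W 0 p = w p.
Hypothesis WY : forall p, U p -> velocity (W ^~ p) 0 = Y p.

Definition pairing_rate q v : R :=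
  ext_d lam (w q) (Y q) (dmap w q v) + dfun (fun p => lam (w p) (Y p)) q v.

(* Cartan's formula: in the chart at w q the two product rules, along the
   variation and along the line through q, share their second-order term. *)
Lemma cartan_variation q v : U q ->
  derive1 (fun s => lam (W s q) (dmap (W s) q v)) 0 = pairing_rate q v.
Proof.
move=> Uq; set p := w q; set c := chart_at p.
have cp : ch_dom c p := chart_atP p.
have Bd u : differentiable ((fun q => lam q (frame c u q)) \o ch_inv c) (ch_map
  c p).
  exact: (oneform_frame_differentiable hl u cp).
have W0q : W 0 q = p by exact: W0.
have l0 : w (line q v 0) = p by rewrite line0.
have cg : derivable_curve (fun s => W s q).
  exact: (variation_curve oU e0 Wc Ws W0 Uq).
have cl : derivable_curve (fun t => w (line q v t)).
  exact: (variation_line_curve oU e0 Wc Ws W0 Uq v).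
pose mv := mixed_derivative w W q v.
have d1 : is_derive (0 : R) 1 (fun s => comp c (W s q) (dmap (W s) q v)) mv.
  exact: (variation_dmap_derive oU e0 Wc Ws W0 Uq v).
have d2 : is_derive (0 : R) 1
    (fun t => comp c (w (line q v t)) (Y (line q v t))) mv.
  exact: (variation_field_derive oU e0 Wc Ws W0 WY Uq v).
have Bl p' : ch_dom c p' -> linear (lam p') by move=> _; exact: hl.1.
have D1 : is_derive (0 : R) 1 (fun s => lam (W s q) (dmap (W s) q v))
    (lam p mv + dfun (fun p => lam p (frame c (dmap w q v) p)) p (Y q)).
  rewrite -(dmap_variation0 oU W0 v Uq) -(WY Uq).
  exact: (tensor_along_curve W0q cg Bl Bd d1).
have D2 : is_derive (0 : R) 1 (fun t => lam (w (line q v t)) (Y (line q v t)))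
    (lam p mv + dfun (fun p => lam p (frame c (Y (line q v 0)) p)) p (dmap w q
      v)).
  exact: (tensor_along_curve l0 cl Bl Bd d2).
rewrite (line0 q v) in D2.
have [_ E1] := D1; rewrite -derive1E in E1.
have [_ E2] := D2; rewrite -derive1E in E2.
apply: etrans E1 (etrans _ (congr1 (+%R _) (esym E2))).
rewrite /ext_d -/p -/c; move: (dfun _ p _) (dfun _ p _) (lam p mv) => a d m'.
by ring.
Qed.
End PullbackVariation.

(** * Restriction to the slice [s = 0] *)

Section Slices.
Context {R : realType} {E F : normedModType R}.
Context {fE : finite_dim E} {fF : finite_dim F}.
Implicit Types (D : set (R * E)%type) (k : nat).

Lemma pair0_cvg (x : E) : (fun y : E => (0, y) : R * E) @ x --> ((0,
  x) : R * E).
Proof. by apply: (@cvg_pair _ _ _ _ (nbhs (0 : R)) (nbhs x));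
  [exact: cvg_cst|exact: cvg_id]. Qed.

Lemma pair0_linear : linear (fun y : E => (0, y) : R * E).
Proof. by move=> a u v; congr pair; rewrite /= scaler0 addr0. Qed.

Lemma Ck_pair0 k (V : set E) : Ck k V (fun y : E => (0, y) : R * E).
Proof.
pose LM := GRing.isLinear.Build _ _ _ _ _ pair0_linear.
pose LL : {linear E -> (R * E)%type} := HB.pack (fun y : E =>
  (0, y) : R * E) LM.
exact: (@Ck_linear _ _ _ k V LL pair0_cvg).
Qed.

Lemma Ck_snd k D : Ck k D snd.
Proof. by apply: (@Ck_linear _ _ _ k D snd) => x; exact: cvg_snd. Qed.

Definition slice0 D := [set x | D (0, x)].

Lemma slice0_open D : open D -> open (slice0 D).
Proof.
move=> oD; rewrite openE => x Dx; rewrite /interior.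
exact: pair0_cvg _ (open_nbhs_nbhs (conj oD Dx)).
Qed.

Lemma Ck_slice0 k D (f : R * E -> F) : open D -> Ck k D f ->
  Ck k (slice0 D) (fun x => f (0, x)).
Proof.
move=> oD fk; apply: (Ck_comp (f := fun x => (0, x)) (V := D)) => //.
- exact: slice0_open.
- exact: Ck_pair0.
Qed.

End Slices.

(** * Joint smoothness of the pulled-back contact form *)

Section PullbackSmoothness.
Context {R : realType} {E F : normedModType R}.
Context {fE : finite_dim E} {fF : finite_dim F}.
Context {M : manifold E} {N : manifold F} {lam : N -> F -> R}.
Hypothesis hl : is_oneform lam.
Variables (U : set M) (W : R -> M -> N) (e : R).
Hypothesis oU : open U.
Hypothesis Wc : forall s p, `|s| < e -> U p ->
  {for (s, p), continuous (fun q : R * M => W q.1 q.2)}.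
Hypothesis Ws : forall b c, smooth_on (variation_dom U W e b c) (variation_map W
  b c).
Variables (b : chart M) (c : chart N).
Let D := variation_dom U W e b c.
Let G := variation_map W b c.

Let oD : open D. Proof. exact: variation_dom_open. Qed.

(** Smoothness of a one-form is given on fields with constant components; expanding [xi] in a
    spanning family reduces to these, composed with the family. *)
Lemma pairing_Ck k (xi : R * E -> F) : Ck k D xi ->
  Ck k D (fun q => lam (W q.1 (ch_inv b q.2)) (frame c (xi q) (W q.1 (ch_inv b
    q.2)))).
Proof.
move=> xik; have [m [f [a [ac aE]]]] := fF.
pose L i := (fun p => lam p (frame c (f i) p)) \o ch_inv c.
have oc : open (ch_map c @` (ch_dom c `&` ch_dom c)).
  exact: ch_image_open (ch_dom_open c).
apply: (Ck_ext (f := fun q => \sum_i a i (xi q) *: (L i \o G) q)) => //.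
  move=> q [_ _ cq]; rewrite [in RHS](aE (xi q)).
  rewrite (linear_fun_sum (frame_linear cq)) (linear_fun_sum (hl.1 _)).
  by apply: eq_bigr => i _; rewrite /L /G /variation_map /= ch_mapK.
apply: Ck_sum => // i; apply: CkZ => //; first exact: Ck_linear_comp.
apply: (Ck_comp oD oc _ (@Ws b c k) (hl.2 c (f i) c k)).
by move=> q [_ _ cq]; exists (W q.1 (ch_inv b q.2)).
Qed.

(** The components of the image of [A] are the derivative of [G] in the spatial direction [A], so
    [pairing_Ck] applies to them. *)
Lemma pullback_Ck k (A : M -> E) : smooth_vf_on (ch_dom b) A ->
  Ck k D (fun q => lam (W q.1 (ch_inv b q.2))
    (dmap (W q.1) (ch_inv b q.2) (A (ch_inv b q.2)))).
Proof.
move=> As; have [m [f [a [ac aE]]]] := fE.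
pose Ab x := comp b (ch_inv b x) (A (ch_inv b x)).
pose xi (q : R * E) := \sum_i a i (Ab q.2) *: 'D_(0, f i) G q.
have ob : open (ch_map b @` (ch_dom b `&` ch_dom b)).
  exact: ch_image_open (ch_dom_open b).
have xik : Ck k D xi.
  apply: Ck_sum => // i; apply: CkZ => //; last exact: Ck_derive (@Ws b c k.+1).
  apply: (Ck_linear_comp oD (ac i) (f := fun q : R * E => Ab q.2)).
  apply: (Ck_comp (f := snd) oD ob _ (Ck_snd _ _) (As b k)).
  by move=> q [_ [p [bp _] pE] _]; exists p.
apply: Ck_ext (pairing_Ck xik) => // -[s x] sxD.
have [/= se bx cx] := sxD.
have [bi Ui xE] := ch_image_inv bx.
rewrite -[dmap _ _ _](compK _ cx) (variation_dmap oU Wc Ws _ se Ui bi cx) xE.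
apply: (congr1 (fun u => lam _ (frame c u _))).
have Gd : differentiable G (s, x) by exact: Ck_differentiable oD (@Ws b c 1)
  sxD.
have P0 : linear (fun u => 'D_(0, u) G (s, x)).
  move=> k' u v; rewrite -(derive_dir_linear Gd) -/(Ab x).
  by congr ('D_ _ G (s, x)); exact: (pair0_linear k' u v).
by rewrite [in RHS](aE (comp b _ _)) (linear_fun_sum P0).
Qed.

End PullbackSmoothness.

Section SecondLinearization.
Context {R : realType} {E F : normedModType R}.
Context {fE : finite_dim E} {fF : finite_dim F}.
Context {M : manifold E} {N : manifold F} {lam : N -> F -> R}.
Hypothesis hl : is_oneform lam.
Variables (U : set M) (w : M -> N) (Y : M -> F) (W : R -> M -> N) (e : R).
Hypothesis oU : open U.
Hypothesis e0 : 0 < e.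
Hypothesis Wc : forall s p, `|s| < e -> U p ->
  {for (s, p), continuous (fun q : R * M => W q.1 q.2)}.
Hypothesis Ws : forall b c, smooth_on (variation_dom U W e b c) (variation_map W
  b c).
Hypothesis W0 : forall p, U p -> W 0 p = w p.
Hypothesis WY : forall p, U p -> velocity (W ^~ p) 0 = Y p.
Variables (z : M) (Uz : U z).
Let b := chart_at z.
Let c := chart_at (w z).
Let y0 := ch_map b z.
Let D := variation_dom U W e b c.
Let f q := lam (w q) (Y q).

Let bz : ch_dom b z. Proof. exact: chart_atP. Qed.

Let oD : open D. Proof. exact: variation_dom_open. Qed.

Let Dy0 : D (0, y0).
Proof.
by apply: variation_dom_mem => //; rewrite ?normr0 // W0 //; exact: chart_atP.
Qed.

Let near_slice : \forall x \near y0, slice0 D x.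
Proof. exact: open_nbhs_nbhs (conj (slice0_open oD) Dy0). Qed.

Let slice_mem x : slice0 D x ->
  [/\ U (ch_inv b x), ch_dom b (ch_inv b x), ch_dom c (W 0 (ch_inv b x))
    & ch_map b (ch_inv b x) = x].
Proof. by move=> [_ /= /ch_image_inv[]]. Qed.

(** On the slice [s = 0] the components of [Y] are the [s]-derivative of the family, so the
    regularity of [lam Y] near [z] comes from that of the family. *)
Lemma pairing_section_Ck k : Ck k (slice0 D) (f \o ch_inv b).
Proof.
have Gk : Ck k D ('D_((1, 0) : R * E) (variation_map W b c)).
  exact: Ck_derive (@Ws b c k.+1).
apply: Ck_ext (Ck_slice0 oD (pairing_Ck hl oU Wc Ws Gk)).
  exact: slice0_open.
move=> x /slice_mem[Ux bx cx xE].
have [_] := variation_velocity oU Wc Ws e0 Ux bx cx.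
rewrite xE => <-; rewrite /= compK // WY // W0 //.
Qed.

Lemma pairing_section_differentiable : differentiable (f \o ch_inv b) y0.
Proof. exact: (Ck_differentiable (slice0_open oD) (pairing_section_Ck 1) Dy0).
  Qed.

Section Field.
Variable A : M -> E.
Hypothesis As : smooth_vf_on (ch_dom b) A.

Let P (q : R * E) := lam (W q.1 (ch_inv b q.2))
    (dmap (W q.1) (ch_inv b q.2) (A (ch_inv b q.2))).

Let Pk k : Ck k D P. Proof. exact: (pullback_Ck hl oU Wc Ws c k As). Qed.

Lemma dfun_pullback s u :
  dfun (fun q => lam (W s q) (dmap (W s) q (A q))) z u = 'D_(0, u) P (s, y0).
Proof. by rewrite dfunE; exact: (derive_snd P). Qed.

Lemma derivable_pullback u : derivable
  (fun s => dfun (fun q => lam (W s q) (dmap (W s) q (A q))) z u) 0 1.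
Proof.
have -> : (fun s => dfun (fun q => lam (W s q) (dmap (W s) q (A q))) z u) =
    fun s => 'D_(0, u) P (s, y0) by apply/funext => s; exact: dfun_pullback.
have Pd : differentiable ('D_(0, u) P) (0, y0).
  exact: (Ck_differentiable oD (Ck_derive (0, u) (Pk 2)) Dy0).
exact: diff_derivable (differentiable_fix_snd Pd).
Qed.

Let rate q := pairing_rate (lam := lam) w Y q (A q).

(** Cartan's formula is needed on a whole neighbourhood of [z], because the identity is then
    differentiated in space. *)
Let rateE x : slice0 D x -> 'D_((1, 0) : R * E) P (0, x) = (rate \o ch_inv b) x.
Proof.
move=> /slice_mem[Ux _ _ _]; rewrite -derive_fst -derive1E.
exact: (cartan_variation hl oU e0 Wc Ws W0 WY (A (ch_inv b x)) Ux).
Qed.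

Let rate_differentiable : differentiable (rate \o ch_inv b) y0.
Proof.
have Pd : differentiable ('D_((1, 0) : R * E) P) (0, y0).
  exact: (Ck_differentiable oD (Ck_derive ((1, 0) : R * E) (Pk 2)) Dy0).
apply: differentiable_near_eq (differentiable_fix_fst Pd).
by apply: filterS near_slice => x; exact: rateE.
Qed.

(** Schwarz for [P], the pulled-back form on [A] as a function of [s] and the coordinates: the
    spatial derivative belongs to [ext_d], the [s]-derivative is the rate in Cartan's formula. *)
Lemma derive_pullback u :
  'D_1 (fun s => dfun (fun q => lam (W s q) (dmap (W s) q (A q))) z u) 0 =
  dfun (fun q => pairing_rate (lam := lam) w Y q (A q)) z u.
Proof.
have -> : (fun s => dfun (fun q => lam (W s q) (dmap (W s) q (A q))) z u) =
    fun s => 'D_(0, u) P (s, y0) by apply/funext => s; exact: dfun_pullback.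
apply: etrans (derive_fst ('D_(0, u) P) 0 y0) _.
apply: etrans (schwarz (0, u) ((1, 0) : R * E) oD Dy0 (Pk 2)) _.
apply: etrans (esym (derive_snd ('D_((1, 0) : R * E) P) 0 y0 u)) _.
apply: etrans _ (esym (dfunE _ _ _)).
by apply: near_eq_derive; apply: filterS near_slice => x; exact: rateE.
Qed.

Lemma dfun_section_differentiable :
  differentiable ((fun q => dfun f q (A q)) \o ch_inv b) y0.
Proof.
have Hk : Ck 1 (slice0 D) (fun x => 'D_(comp b (ch_inv b x) (A (ch_inv b x)))
    (f \o ch_inv b) x).
  apply: Ck_derive_along (slice0_open oD) (pairing_section_Ck 2) _.
  apply: Ck_subset (As b 1) => x /slice_mem[Ux bx _ <-].
  by exists (ch_inv b x).
apply: (Ck_differentiable (slice0_open oD) _ Dy0).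
apply: Ck_ext (slice0_open oD) _ Hk => x Dx.
have [Ux bx _ xE] := slice_mem Dx.
have fd : differentiable (f \o ch_inv b) (ch_map b (ch_inv b x)).
  by rewrite xE; exact: Ck_differentiable (slice0_open oD) (pairing_section_Ck
    1) Dx.
by apply/esym; apply: etrans (dfun_chart _ bx fd) _; rewrite xE.
Qed.

(** Splitting the derivative of the sum requires both summands to be differentiable. For the
    [ext_d lam] part this follows by subtraction, as the rate and the [dfun f] part are already
    known to be so. *)
Lemma dfun_pairing_rate u :
  dfun (fun q => pairing_rate (lam := lam) w Y q (A q)) z u =
  dfun (fun q => dfun f q (A q)) z u +
  dfun (fun q => ext_d lam (w q) (Y q) (dmap w q (A q))) z u.
Proof.
have d2 := dfun_section_differentiable.
have d1 : differentiable
    ((fun q => ext_d lam (w q) (Y q) (dmap w q (A q))) \o ch_inv b) y0.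
  have -> : (fun q => ext_d lam (w q) (Y q) (dmap w q (A q))) \o ch_inv b =
      (rate \o ch_inv b) \- ((fun q => dfun f q (A q)) \o ch_inv b).
    by apply/funext => x; rewrite /= /rate /pairing_rate addrK.
  exact: differentiableB.
by rewrite -(dfunD u bz d2 d1); apply: (congr1 (fun g => dfun g z u));
  apply/funext => q; rewrite /pairing_rate addrC.
Qed.

End Field.

Lemma second_linearization (j : M -> E -> E) (hj : is_endo j) u v :
  derive1 (fun s => ext_d (fun q x => lam (W s q) (dmap (W s) q (j q x))) z u v)
    0 =
  ext_d (fun q x => dfun f q (j q x)) z u v +
  ext_d (fun q x => ext_d lam (w q) (Y q) (dmap w q (j q x))) z u v.
Proof.
pose A u q := j q (frame b u q).
have As u' : smooth_vf_on (ch_dom b) (A u') := hj.2 b u'.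
rewrite derive1E.
pose g u v s := dfun (fun q => lam (W s q) (dmap (W s) q (A v q))) z u.
(* By definition [ext_d] is a difference of two [dfun] terms, each evaluated on a field
   [j (frame b _)]. *)
transitivity ('D_1 (g u v - g v u) 0); first by [].
have d u' v' : derivable (g u' v') 0 1 by exact: (derivable_pullback (As v')).
apply: etrans (deriveB (d u v) (d v u)) _.
have r u' v' : 'D_1 (g u' v') 0 = dfun (fun q => dfun f q (A v' q)) z u' +
    dfun (fun q => ext_d lam (w q) (Y q) (dmap w q (A v' q))) z u'.
  exact: etrans (derive_pullback (As v') u') (dfun_pairing_rate (As v') u').
apply: etrans (congr2 (fun a b => a - b) (r u v) (r v u)) _.
have alg (a1 a2 a3 a4 : R) : a1 + a2 - (a3 + a4) = a1 - a3 + (a2 - a4).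
  by rewrite opprD addrACA.
exact: alg.
Qed.

End SecondLinearization.

(** * The Laplacian and the form [df o j] *)

Section Laplacian.
Context {R : realType}.
Local Notation E := 'rV[R]_2.
Local Notation e0 := (delta_mx 0 0 : E).
Local Notation e1 := (delta_mx 0 1 : E).

Lemma alternating_form2 (omega : E -> E -> R) u v :
  (forall v, scalar (omega ^~ v)) -> (forall u v, omega u v = - omega v u) ->
  omega u v = (u 0 0 * v 0 1 - u 0 1 * v 0 0) * omega e0 e1.
Proof.
move=> ol oa.
have oD u1 u2 x : omega (u1 + u2) x = omega u1 x + omega u2 x.
  exact: (linear_funD (ol x)).
have oZ k u1 x : omega (k *: u1) x = k * omega u1 x
  by exact: (linear_funZ (ol x)).
have dec (x : E) : x = x 0 0 *: e0 + x 0 1 *: e1.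
  rewrite {1}[x]row_sum_delta big_ord_recl big_ord1.
  by congr (_ + x _ _ *: delta_mx _ _); apply/val_inj.
have o0 x : omega x x = 0.
  by have := oa x x; lra.
rewrite (dec u) oD !oZ [omega e0 v]oa [omega e1 v]oa (dec v) !oD !oZ !o0.
by rewrite [omega e1 e0]oa !mxE /=; ring.
Qed.

Context {S : manifold E} {j : S -> E -> E} {h : S -> E -> E -> R}.
Hypothesis hj : is_complex_structure j.
Hypothesis hh : is_kaehler_metric j h.
Implicit Types (q z : S) (u v : E).

Lemma metric_scalar q u : scalar (h q u). Proof. by case: hh. Qed.

Lemma metric_sym q u v : h q u v = h q v u. Proof. by case: hh. Qed.

Lemma metric_j q u v : h q (j q u) v = - h q u (j q v).
Proof.
have [_ _ _ hJ _] := hh; rewrite -hJ hj.2 [LHS]metric_sym.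
by rewrite (linear_funN (metric_scalar q _)) metric_sym.
Qed.

Lemma area_scalar q v : scalar (area_form j h q ^~ v).
Proof.
move=> k u u'; rewrite /area_form (hj.1.1 q) ![h q _ v]metric_sym.
exact: metric_scalar.
Qed.

Lemma area_antisym q u v : area_form j h q u v = - area_form j h q v u.
Proof. by rewrite /area_form metric_j metric_sym. Qed.

(** Otherwise the form would vanish identically, whereas its value at [(j e0, e0)] is
    [- h e0 e0 < 0]. *)
Lemma area_neq0 q : area_form j h q e0 e1 != 0.
Proof.
apply/eqP => a0.
have e00 : e0 != 0.
  by apply/eqP => /rowP/(_ 0); rewrite !mxE eqxx /= => /eqP; rewrite oner_eq0.
have [_ _ hpos _ _] := hh.
have := hpos q e0 e00; rewrite -[e0 in h q e0 _]opprK -(hj.2 q e0).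
rewrite metric_sym (linear_funN (metric_scalar q _)) metric_sym.
rewrite -/(area_form j h q (j q e0) e0).
rewrite (alternating_form2 _ _ (area_scalar q) (area_antisym q)) a0 mulr0.
by rewrite oppr0 ltxx.
Qed.

Lemma metric_matrix q u v (H := \matrix_(i, k) h q (delta_mx 0 i) (delta_mx 0
  k)) :
  h q u v = \sum_k v 0 k * (u *m H) 0 k.
Proof.
rewrite {1}[v]row_sum_delta (linear_fun_sum (metric_scalar q u)).
apply: eq_bigr => k _; apply: (congr1 ( *%R _)).
rewrite metric_sym {1}[u]row_sum_delta (linear_fun_sum (metric_scalar q _)) mxE.
by apply: eq_bigr => i _; rewrite mxE metric_sym.
Qed.

(** The inverse in [grad] is a true inverse: a vector in the kernel of the Gram matrix would have
    zero length, against positivity of [h]. *)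
Lemma grad_dual (f : S -> R) q v : scalar (dfun f q) ->
  h q (grad h f q) v = dfun f q v.
Proof.
move=> fl; rewrite metric_matrix /grad; set H := \matrix_(i, k) h q _ _.
have Hu : H \in unitmx.
  rewrite unitmxE unitfE; apply/negP => /det0P[u u0 uH].
  have [_ _ hpos _ _] := hh; have := hpos q u u0.
  by rewrite metric_matrix -/H uH big1 ?ltxx // => k _; rewrite mxE mulr0.
rewrite mulmxKV // {2}[v]row_sum_delta (linear_fun_sum fl).
by apply: eq_bigr => k _; rewrite mxE.
Qed.

Lemma area_grad (f : S -> R) q v : scalar (dfun f q) ->
  area_form j h q (grad h f q) v = - dfun f q (j q v).
Proof. by move=> fl; rewrite /area_form metric_j grad_dual. Qed.

(** Both sides are alternating on a plane, so the pair [(e0, e1)] decides. There [area_grad] makes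
    the numerator of the divergence the negative of the left-hand side, and the denominator is the
    area form itself. *)
Lemma laplacian_area (f : S -> R) z u v (b := chart_at z) :
  (\forall q \near z, scalar (dfun f q)) ->
  (forall u, differentiable ((fun q => dfun f q (j q (frame b u q))) \o ch_inv
    b)
    (ch_map b z)) ->
  ext_d (fun q x => dfun f q (j q x)) z u v =
  - laplacian j h f z * area_form j h z u v.
Proof.
move=> fl fd; set beta := fun q x => dfun f q (j q x).
have bz : ch_dom b z := chart_atP z.
have al : \forall q \near z, scalar (beta q).
  by apply: filterS fl => q fl k x y; rewrite /beta (hj.1.1 q) fl.
have bl y : scalar (ext_d beta z ^~ y) by exact: ext_d_linear_l.
rewrite (alternating_form2 _ _ bl (@ext_d_antisym _ _ _ beta z)).
rewrite (alternating_form2 _ _ (area_scalar z) (area_antisym z)).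
have E1 x y : dfun (fun q => area_form j h q (grad h f q) (frame b y q)) z x =
    - dfun (fun q => beta q (frame b y q)) z x.
  transitivity (dfun (fun q => - beta q (frame b y q)) z x).
    by apply: dfun_near_eq; apply: filterS fl => q fl; exact: area_grad.
  apply: etrans (dfunE _ _ _) (etrans _ (congr1 -%R (esym (dfunE _ _ _)))).
  exact: deriveN (diff_derivable (fd y)).
have E2 : ext_d (fun q => area_form j h q (grad h f q)) z e0 e1 =
    - ext_d beta z e0 e1.
  apply: etrans (congr2 (fun a b => a - b) (E1 e0 e1) (E1 e1 e0)) _.
  by rewrite -opprD.
rewrite /laplacian /divergence E2.
move: (ext_d _ _ _ _) (area_neq0 z) => r a0.
by field.
Qed.

End Laplacian.

Theorem theorem1p10 (R : realType) (n : nat)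
    (Q : manifold 'rV[R]_(n.*2.+1))
    (lam : Q -> 'rV[R]_(n.*2.+1) -> R)
    (J : Q -> 'rV[R]_(n.*2.+1) -> 'rV[R]_(n.*2.+1))
    (X : Q -> 'rV[R]_(n.*2.+1))
    (hQ : contact_triad lam J X)
    (nabla : Q -> 'rV[R]_(n.*2.+1) -> (Q -> 'rV[R]_(n.*2.+1)) ->
             'rV[R]_(n.*2.+1))
    (hnabla : triad_connection lam J X nabla)
    (S : manifold 'rV[R]_2)
    (j : S -> 'rV[R]_2 -> 'rV[R]_2)
    (hj : is_complex_structure j)
    (hS : closed_or_punctured j)
    (h : S -> 'rV[R]_2 -> 'rV[R]_2 -> R)
    (hh : is_kaehler_metric j h)
    (w : S -> Q)
    (hw : smooth_map_on setT w)
    (Y : S -> 'rV[R]_(n.*2.+1))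
    (hY : smooth_along w Y)
    (U : set S) (hU : open U)
    (W : R -> S -> Q)
    (hW : is_variation w Y U W)
    (z : S) (hz : U z) :
  (forall v : 'rV[R]_2,
     DUpsilon1 lam J X nabla j W z v =
       dbar_nabla_pi lam J X nabla j w (sec_pi lam X w Y) z v
       + part01 J j w (T_pi lam X nabla w (sec_pi lam X w Y)) z v
       + part01 J j w (B_op lam J X w (sec_pi lam X w Y)) z v
       + (2^-1 * sec_lam lam w Y z) *:
           lie_endo X J (w z) (J (w z) (del_pi lam J X j w z v))) /\
  (forall u v : 'rV[R]_2,
     DUpsilon2 lam j W z u v =
       - laplacian j h (sec_lam lam w Y) z * area_form j h z u v
       + ext_d (fun q x =>
           contract_dlam lam w (sec_pi lam X w Y) q (j q x)) z u v).
Proof.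
have [[e e0 [Wc Ws]] W0 WY] := hW.
have hl : is_oneform lam := lam_oneform hQ.
split=> [v|u v]; first exact: (first_linearization hQ hnabla j hU e0 Wc Ws W0 WY
  hz v).
pose f := sec_lam lam w Y.
(* Any [q] in [U] may play the role of the base point [z], which gives differentiability of [lam Y]
   on all of [U]. *)
have fl : \forall q \near z, scalar (dfun f q).
  apply: filterS (open_nbhs_nbhs (conj hU hz)) => q Uq.
  apply: (dfun_linear (chart_atP q)).
  exact: (pairing_section_differentiable hl hU e0 Wc Ws W0 WY Uq).
have fd y : differentiable ((fun q => dfun f q (j q (frame (chart_at z) y q)))
    \o ch_inv (chart_at z)) (ch_map (chart_at z) z).
  exact: (dfun_section_differentiable hl hU e0 Wc Ws W0 WY hz (hj.1.2 _ y)).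
apply: etrans (second_linearization hl hU e0 Wc Ws W0 WY hz hj.1 u v) _.
apply: (congr2 +%R); first exact: laplacian_area.
apply: (congr1 (fun alpha => ext_d alpha z u v)).
by apply/funext => q; apply/funext => x; exact: esym (ext_d_proj hQ _ _ _).
Qed.
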